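(* Let $\mathcal M$ be an o-minimal expansion of a real closed field $R$ and let $G$ be a definably connected definable group with Lie algebra $\mathcal G$. Assume $\mathcal G=\mathcal A+\mathcal I$, where $\mathcal A$ is a central subalgebra of $\mathcal G$ and $\mathcal I\subseteq\mathcal G$ is an ideal. Then $L([G,G])\subseteq\mathcal I$.
   Context: For a definable group $G$ in an o-minimal expansion of a real closed field $R$, its Lie algebra $\mathcal G$ has underlying $R$-vector space the tangent space $T_e(G)$, with the bracket defined as for Lie groups (via differentials of conjugation $Ad_g=d_e(x\mapsto gxg^{-1})$); a subspace is an ideal iff it is $Ad_g$-invariant for all $g\in G$, and a subalgebra $\mathcal A$ is central if $[\xi,\eta]=0$ for all $\xi\in\mathcal A,\eta\in\mathcal G$. The commutator subgroup $[G,G]=\bigcup_n[G,G]_n$ (where $[G,G]_n$ is the definable set of products of $n$ commutators) is a locally definable subgroup: in some neighbourhood $U$ of $e$ it coincides with the definable set $U\cap[G,G]_n$ for some $n$; $L([G,G])\subseteq\mathcal G$ denotes its associated Lie subalgebra, i.e. the tangent space at $e$ of $[G,G]$. *)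

(* Defs.v *)
From HB Require Import structures.
From mathcomp Require Import all_boot all_order all_algebra.
From mathcomp Require Import classical_sets reals topology normedtype derive.

Set Implicit Arguments.
Unset Strict Implicit.
Unset Printing Implicit Defensive.

Import Order.TTheory GRing.Theory Num.Theory.
Import numFieldNormedType.Exports.

Local Open Scope classical_set_scope.
Local Open Scope ring_scope.

(* An o-minimal expansion of the ordered field R, given by its definable sets
   (with parameters) as in van den Dries: [definable n] is the boolean algebra
   of definable subsets of R^n, with R^n the type of row vectors.  An
   [interval R] may be a point, bounded or not, with or without its bounds. *)
Record ominimal (R : rcfType) := Ominimal {
  definable : forall n : nat, set 'rV[R]_n -> Prop;
  definableT : forall n, definable (@setT 'rV[R]_n);
  definableC : forall n (A : set 'rV[R]_n), definable A -> definable (~` A);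
  definableU : forall n (A B : set 'rV[R]_n),
    definable A -> definable B -> definable (A `|` B);
  definableX : forall m n (A : set 'rV[R]_m) (B : set 'rV[R]_n),
    definable A -> definable B ->
    definable [set w : 'rV[R]_(m + n) | A (lsubmx w) /\ B (rsubmx w)];
  definable_proj : forall m n (A : set 'rV[R]_(m + n)),
    definable A -> definable [set lsubmx w | w in A];
  definable_eq : forall n (i j : 'I_n),
    definable [set w : 'rV[R]_n | w 0 i = w 0 j];
  definable_lt : forall n (i j : 'I_n),
    definable [set w : 'rV[R]_n | w 0 i < w 0 j];
  definable_add : forall n (i j k : 'I_n),
    definable [set w : 'rV[R]_n | w 0 i + w 0 j = w 0 k];
  definable_mul : forall n (i j k : 'I_n),
    definable [set w : 'rV[R]_n | w 0 i * w 0 j = w 0 k];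
  definable_point : forall a : R, definable [set w : 'rV[R]_1 | w 0 0 = a];
  ominimality : forall A : set 'rV[R]_1, definable A ->
    exists s : seq (interval R),
      forall x : R, A (const_mx x) <-> exists2 J, J \in s & x \in J
}.

Definition definable_map (R : rcfType) (M : ominimal R) (m n : nat)
    (A : set 'rV[R]_m) (f : 'rV[R]_m -> 'rV[R]_n) : Prop :=
  definable M [set w : 'rV[R]_(m + n) | A (lsubmx w) /\ rsubmx w = f (lsubmx w)].

(* Meant for U open; values of f outside U are irrelevant. *)
Fixpoint Ck (R : rcfType) (V W : normedModType R) (k : nat)
    (U : set V) (f : V -> W) : Prop :=
  match k with
  | 0 => forall x, U x -> {for x, continuous f}
  | k'.+1 => (forall x, U x -> differentiable f x) /\
             (forall v : V, Ck k' U (fun x => 'D_v f x : W))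
  end.

(* The operations are total functions on R^N, constrained on the carrier only. *)
Record defGroup (R : rcfType) (M : ominimal R) (N : nat) := DefGroup {
  carrier :> set 'rV[R]_N;
  gmul : 'rV[R]_N -> 'rV[R]_N -> 'rV[R]_N;
  ginv : 'rV[R]_N -> 'rV[R]_N;
  gone : 'rV[R]_N;
  carrier_def : definable M carrier;
  mul_def : definable_map M
    [set w : 'rV[R]_(N + N) | carrier (lsubmx w) /\ carrier (rsubmx w)]
    (fun w => gmul (lsubmx w) (rsubmx w));
  mul_closed : forall x y, carrier x -> carrier y -> carrier (gmul x y);
  inv_closed : forall x, carrier x -> carrier (ginv x);
  one_closed : carrier gone;
  gmulA : forall x y z, carrier x -> carrier y -> carrier z ->
    gmul x (gmul y z) = gmul (gmul x y) z;
  gmul1 : forall x, carrier x -> gmul gone x = x /\ gmul x gone = x;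
  gmulV : forall x, carrier x -> gmul (ginv x) x = gone /\ gmul x (ginv x) = gone
}.

(* A definable C^p manifold structure of dimension d on G (finitely many
   definable charts) for which G is a C^p group.  By Pillay's theorem one exists
   for every p, and it is unique up to definable C^p isomorphism. *)
Record defAtlas (R : rcfType) (M : ominimal R) (N : nat) (G : defGroup M N)
    (p d : nat) := DefAtlas {
  idx : finType;
  dom : idx -> set 'rV[R]_N;
  chart : idx -> 'rV[R]_N -> 'rV[R]_d;
  chart_inv : idx -> 'rV[R]_d -> 'rV[R]_N;
  dom_def : forall i, definable M (dom i);
  dom_cover : forall x, carrier G x <-> exists i, dom i x;
  chart_def : forall i, definable_map M (dom i) (chart i);
  chartK : forall i x, dom i x -> chart_inv i (chart i x) = x;
  transition_open : forall i j, open [set chart i x | x in dom i `&` dom j];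
  transition_Ck : forall i j,
    Ck p [set chart i x | x in dom i `&` dom j]
      (fun u => chart j (chart_inv i u));
  mul_open : forall i j k,
    open [set w : 'rV[R]_(d + d) |
      [/\ [set chart i x | x in dom i] (lsubmx w),
          [set chart j x | x in dom j] (rsubmx w) &
          dom k (gmul G (chart_inv i (lsubmx w)) (chart_inv j (rsubmx w)))]];
  mul_Ck : forall i j k,
    Ck p [set w : 'rV[R]_(d + d) |
      [/\ [set chart i x | x in dom i] (lsubmx w),
          [set chart j x | x in dom j] (rsubmx w) &
          dom k (gmul G (chart_inv i (lsubmx w)) (chart_inv j (rsubmx w)))]]
      (fun w => chart k (gmul G (chart_inv i (lsubmx w))
                               (chart_inv j (rsubmx w))));
  inv_open : forall i j,
    open [set chart i x | x in dom i `&` [set x | dom j (ginv G x)]];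
  inv_Ck : forall i j,
    Ck p [set chart i x | x in dom i `&` [set x | dom j (ginv G x)]]
      (fun u => chart j (ginv G (chart_inv i u)))
}.

Section LieAlgebra.
Variables (R : rcfType) (M : ominimal R) (N : nat) (G : defGroup M N).
Variables (p d : nat) (X : defAtlas G p d).

Definition manifold_open (U : set 'rV[R]_N) : Prop :=
  U `<=` G /\ forall i : idx X, open [set chart i x | x in U `&` dom i].

Definition definably_connected : Prop :=
  forall U : set 'rV[R]_N, definable M U -> U `<=` G ->
    manifold_open U -> manifold_open (G `\` U) -> U = set0 \/ U = G.

(* Below, i is a chart around the identity, through which the tangent space
   at the identity is identified with R^d. *)

Definition Ad (i : idx X) (g : 'rV[R]_N) (eta : 'rV[R]_d) : 'rV[R]_d :=
  'd (fun u : 'rV[R]_d => chart i (gmul G (gmul G g (chart_inv i u)) (ginv G g)))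
     (chart i (gone G)) eta.

(* [xi, eta] = (d_e Ad)(xi)(eta). *)
Definition bracket (i : idx X) (xi eta : 'rV[R]_d) : 'rV[R]_d :=
  'd (fun u : 'rV[R]_d => Ad i (chart_inv i u) eta) (chart i (gone G)) xi.

Definition subalgebra (i : idx X) (A : {vspace 'rV[R]_d}) : Prop :=
  forall xi eta, xi \in A -> eta \in A -> bracket i xi eta \in A.

Definition central (i : idx X) (A : {vspace 'rV[R]_d}) : Prop :=
  forall xi eta, xi \in A -> bracket i xi eta = 0.

Definition ideal (i : idx X) (I : {vspace 'rV[R]_d}) : Prop :=
  forall xi eta, xi \in I -> bracket i xi eta \in I.

Definition commutator (x y : 'rV[R]_N) : 'rV[R]_N :=
  gmul G (gmul G x y) (gmul G (ginv G x) (ginv G y)).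

(* [G, G]_n *)
Fixpoint commutator_products (n : nat) : set 'rV[R]_N :=
  match n with
  | 0 => [set gone G]
  | n'.+1 => [set z | exists c x y,
      [/\ commutator_products n' c, carrier G x, carrier G y & z = gmul G c (commutator x y)]]
  end.

Definition commutator_subgroup : set 'rV[R]_N :=
  \bigcup_n commutator_products n.

(* Tangent space at the identity: velocities of definable C^1 curves in S. *)
Definition tangent (i : idx X) (S : set 'rV[R]_N) : set 'rV[R]_d :=
  [set xi | exists (eps : R) (gamma : R -> 'rV[R]_N),
    0 < eps /\
    definable_map M [set t : 'rV[R]_1 | `|t 0 0| < eps]
      (fun t => gamma (t 0 0)) /\
    gamma 0 = gone G /\
    (forall t, `|t| < eps -> S (gamma t) /\ dom i (gamma t)) /\
    Ck 1 [set t : R | `|t| < eps] (fun t => chart i (gamma t)) /\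
    (fun t => chart i (gamma t))^`()%classic 0 = xi].

(* L([G, G]): near the identity the locally definable subgroup [G, G] is the
   definable set U `&` [G, G]_n for some n, whose tangent space is taken. *)
Definition Lie_commutator_subgroup (i : idx X) : set 'rV[R]_d :=
  [set xi | exists (n : nat) (U : set 'rV[R]_N),
    [/\ definable M U, manifold_open U, U (gone G),
        U `&` commutator_subgroup = U `&` commutator_products n &
        tangent i (U `&` commutator_products n) xi]].

End LieAlgebra.

(* Main.v *)
(* Write L for the Lie algebra. Centrality of A, the ideal property of I and
   A + I = L give [xi, eta] in I for all xi and eta, so modulo I the map
   g |-> Ad_g has zero derivative: its differential at g along a right-translated
   xi is [xi, Ad_g .]. The set of g acting trivially on L / I is therefore a
   definable subgroup containing a neighbourhood of the identity, and is all of G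
   by definable connectedness.

   Let gamma be a definable curve with gamma(t) = e(t) [x(t), y(t)]. By definable
   choice e, x and y may be taken definable, and a definable function of one
   variable is right-Lipschitz at every point of some subinterval. Since Ad is
   trivial modulo I, right-translated increments of curves are additive modulo I
   to first order; from gamma y x = e x y the increments of gamma agree with those
   of e, and by induction on the number of commutators they are o(t - s) modulo I.
   Hence the right-translated velocity of gamma lies in I at points arbitrarily
   close to 0, and by continuity so does gamma'(0). *)

(* The field [R] is an arbitrary real closed field, where compactness, integration and the mean
   value theorem may fail, so every passage from local to global runs through the description of
   definable subsets of the line as finite unions of intervals. In place of cell decomposition and
   the monotonicity theorem, statements are proved on some subinterval of a given interval, which is
   shrunk as often as needed; this is why velocities are examined at points close to 0 and not at 0
   itself. The factors chosen for a curve of commutators come with no regularity. Right-Lipschitz is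
   what can be obtained for them, and it suffices because all estimates on increments are one-sided
   and of first order. Definability has to be produced as well: the operations, the charts and [Ad]
   are replaced by definable total functions agreeing with them where they are meaningful. Second
   derivatives of the product, hence [2 <= p], serve to differentiate [Ad]. Working modulo the ideal
   means multiplying on the right by a matrix [P] with kernel [I]. *)
Require Import Defs.
From HB Require Import structures.
From mathcomp Require Import all_boot all_order all_algebra.
From mathcomp Require Import classical_sets reals topology normedtype derive.
From mathcomp Require Import landau boolp ring lra.

Set Implicit Arguments.
Unset Strict Implicit.
Unset Printing Implicit Defensive.

Import Order.TTheory GRing.Theory Num.Theory.
Import numFieldNormedType.Exports.

Local Open Scope classical_set_scope.
Local Open Scope ring_scope.

(** * Definable predicates and functions *)

(* Products of R and of spaces of row vectors, identified with some R^n, so that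
   formulas can be written with named variables instead of coordinates. *)
Class Enc (R : rcfType) (T : Type) := MkEnc {
  edim : nat;
  code : T -> 'rV[R]_edim;
  decode : 'rV[R]_edim -> T;
  codeK : cancel code decode;
  decodeK : cancel decode code
}.
Arguments edim {R} T {_}.
Arguments code {R T _}.
Arguments decode {R T _}.

#[export] Instance enc_rV (R : rcfType) n : Enc R 'rV[R]_n :=
  @MkEnc R _ n id id (fun _ => erefl) (fun _ => erefl).

Lemma enc_realK (R : rcfType) :
  cancel (fun x : R => const_mx x : 'rV[R]_1) (fun w => w 0 0).
Proof. by move=> x; rewrite mxE. Qed.

Lemma enc_realVK (R : rcfType) :
  cancel (fun w : 'rV[R]_1 => w 0 0) (fun x : R => const_mx x : 'rV[R]_1).
Proof. by move=> w; apply/rowP => j; rewrite mxE ord1. Qed.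

#[export] Instance enc_real (R : rcfType) : Enc R R :=
  MkEnc (@enc_realK R) (@enc_realVK R).

Section EncProd.
Context (R : rcfType) (T U : Type) {eT : Enc R T} {eU : Enc R U}.

Let f (x : T * U) : 'rV[R]_(edim T + edim U) := row_mx (code x.1) (code x.2).
Let g (w : 'rV[R]_(edim T + edim U)) : T * U :=
  (decode (lsubmx w), decode (rsubmx w)).

Lemma enc_prodK : cancel f g.
Proof. by case=> x y; rewrite /g row_mxKl row_mxKr !codeK. Qed.

Lemma enc_prodVK : cancel g f.
Proof. by move=> w; rewrite /f !decodeK hsubmxK. Qed.

#[export] Instance enc_prod : Enc R (T * U) := MkEnc enc_prodK enc_prodVK.
End EncProd.

Section Definable.
Variables (R : rcfType) (M : ominimal R).

Definition dpred T {eT : Enc R T} (P : T -> Prop) : Prop :=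
  definable M [set w | P (decode w)].

(** Functions are total; a partial operation is handled through a definable total extension of
    it. *)
Definition dfun T U {eT : Enc R T} {eU : Enc R U} (f : T -> U) : Prop :=
  dpred (fun p : T * U => p.2 = f p.1).

Lemma eq_definable n (A B : set 'rV[R]_n) :
  definable M A -> (forall w, A w <-> B w) -> definable M B.
Proof.
by move=> dA e; rewrite (_ : B = A) //; apply/seteqP; split=> w /=; apply e.
Qed.

Lemma eq_dpred T {eT : Enc R T} (P Q : T -> Prop) :
  dpred P -> (forall x, P x <-> Q x) -> dpred Q.
Proof.
move=> dP e; move: dP; rewrite /dpred; congr (definable M _).
by apply/seteqP; split=> w /=; apply e.
Qed.

Lemma dtrue T {eT : Enc R T} : dpred (fun _ : T => True).
Proof. exact: definableT. Qed.

Lemma dnot T {eT : Enc R T} (P : T -> Prop) :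
  dpred P -> dpred (fun x => ~ P x).
Proof. exact: definableC. Qed.

Lemma dor T {eT : Enc R T} (P Q : T -> Prop) :
  dpred P -> dpred Q -> dpred (fun x => P x \/ Q x).
Proof. exact: definableU. Qed.

Lemma dand T {eT : Enc R T} (P Q : T -> Prop) :
  dpred P -> dpred Q -> dpred (fun x => P x /\ Q x).
Proof.
move=> dP dQ; apply: (@eq_dpred T eT (fun x => ~ (~ P x \/ ~ Q x))).
  by apply/dnot/dor; apply/dnot.
by move=> x; split=> [/not_orP[] /contrapT ? /contrapT ?//|[? ?] []].
Qed.

Lemma dimp T {eT : Enc R T} (P Q : T -> Prop) :
  dpred P -> dpred Q -> dpred (fun x => P x -> Q x).
Proof.
move=> dP dQ; apply: (@eq_dpred T eT (fun x => ~ P x \/ Q x)).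
  by apply: dor => //; apply: dnot.
by move=> x; split=> [[]//|h]; have [/h|] := pselect (P x); [right|left].
Qed.

Lemma dall_fin T {eT : Enc R T} (I : finType) (P : I -> T -> Prop) :
  (forall k, dpred (P k)) -> dpred (fun x => forall k, P k x).
Proof.
move=> dP.
suff: @dpred T eT (fun x => forall k, k \in enum I -> P k x).
  by move/eq_dpred; apply=> x; split=> h k *; apply: h; rewrite ?mem_enum.
elim: (enum I) => [|a s IH]; first by apply: (eq_dpred dtrue).
apply: (eq_dpred (dand (dP a) IH)) => x; split=> [[Pk Ps] j|h].
  by rewrite inE => /predU1P[->|/Ps].
by split=> [|j js]; apply: h; rewrite inE ?eqxx // js orbT.
Qed.

Lemma dex_fin T {eT : Enc R T} (I : finType) (P : I -> T -> Prop) :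
  (forall k, dpred (P k)) -> dpred (fun x => exists k, P k x).
Proof.
move=> dP; apply: (eq_dpred (dnot (dall_fin (fun k => dnot (dP k))))) => x.
by split=> [/existsNP[k /contrapT]|[k Pk] /(_ k)]; [exists k|].
Qed.

Lemma dex T U {eT : Enc R T} {eU : Enc R U} (P : T -> U -> Prop) :
  dpred (fun p : T * U => P p.1 p.2) -> dpred (fun x => exists y, P x y).
Proof.
move=> dP; have := @definable_proj R M (edim T) (edim U) _ dP.
rewrite /dpred; congr (definable M _).
apply/seteqP; split=> w /=; first by case=> v Pv <-; exists (decode (rsubmx v)).
case=> y Py; exists (row_mx w (code y)); rewrite ?row_mxKl //=.
by rewrite row_mxKr codeK.
Qed.

Lemma dall T U {eT : Enc R T} {eU : Enc R U} (P : T -> U -> Prop) :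
  dpred (fun p : T * U => P p.1 p.2) -> dpred (fun x => forall y, P x y).
Proof.
move=> dP; apply: (eq_dpred (dnot (dex (P := fun x y => ~ P x y) (dnot dP)))) => x.
split=> [h y|h [y]]; last by apply.
by apply: contrapT => nP; apply: h; exists y.
Qed.

(** Coordinate selections, which rearrange, repeat or drop variables. Coordinate equalities alone
    cut out their graphs, so they are available before closure under composition and pairing. *)
Definition dproj T U {eT : Enc R T} {eU : Enc R U} (f : T -> U) : Prop :=
  exists s : 'I_(edim U) -> 'I_(edim T),
    forall x k, code (f x) 0 k = code x 0 (s k).

Lemma dproj_dfun T U {eT : Enc R T} {eU : Enc R U} (f : T -> U) :
  dproj f -> dfun f.
Proof.
case=> s sE.
have D k : dpred (fun p : T * U => code p.2 0 k = code p.1 0 (s k)).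
  apply: (eq_definable
    (@definable_eq R M _ (rshift (edim T) k) (lshift (edim U) (s k)))) => w.
  by rewrite /= !decodeK !mxE.
apply: (eq_dpred (dall_fin D)) => p; split=> [h|-> k//].
by apply: (can_inj codeK); apply/rowP => k; rewrite h sE.
Qed.


Lemma dproj_id T {eT : Enc R T} : dproj (fun x : T => x).
Proof. by exists id. Qed.

Lemma dproj_fst T {eT : Enc R T} U {eU : Enc R U} V {eV : Enc R V}
    (f : T -> U * V) : dproj f -> dproj (fun x => (f x).1).
Proof.
case=> s sE; exists (s \o lshift _) => x k.
by rewrite -(sE x (lshift _ k)) /= row_mxEl.
Qed.

Lemma dproj_snd T {eT : Enc R T} U {eU : Enc R U} V {eV : Enc R V}
    (f : T -> U * V) : dproj f -> dproj (fun x => (f x).2).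
Proof.
case=> s sE; exists (s \o @rshift _ _) => x k.
by rewrite -(sE x (rshift _ k)) /= row_mxEr.
Qed.

Lemma dproj_pair T {eT : Enc R T} U {eU : Enc R U} V {eV : Enc R V}
    (f : T -> U) (g : T -> V) :
  dproj f -> dproj g -> dproj (fun x => (f x, g x)).
Proof.
case=> s sE [t tE].
exists (fun k => match split k with inl a => s a | inr b => t b end) => x k.
by rewrite /= mxE; case: split => a; rewrite -?sE -?tE.
Qed.

Lemma dproj_coord T {eT : Enc R T} n (f : T -> 'rV[R]_n) j :
  dproj f -> dproj (fun x => f x 0 j : R).
Proof. by case=> s sE; exists (fun=> s j) => x k; rewrite -sE /= mxE. Qed.

(** The preimage is the projection of the graph of [f] intersected with the cylinder over [P]. *)
Lemma dpred_proj T {eT : Enc R T} U {eU : Enc R U} (f : T -> U) (P : U -> Prop) :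
  dproj f -> dpred P -> dpred (fun x => P (f x)).
Proof.
move=> /dproj_dfun df dP.
have dP2 : dpred (fun p : T * U => P p.2).
  by apply: (eq_definable (definableX (@definableT R M (edim T)) dP)) => w; split=> [[]|].
apply: (eq_dpred (dex (P := fun x y => y = f x /\ P y) (dand df dP2))) => x.
by split=> [[y [->]]//|Px]; exists (f x).
Qed.

Lemma dpred_comp T {eT : Enc R T} U {eU : Enc R U} (f : T -> U) (P : U -> Prop) :
  dfun f -> dpred P -> dpred (fun x => P (f x)).
Proof.
move=> df dP.
have dP2 : dpred (fun p : T * U => P p.2).
  by apply: dpred_proj dP; apply/dproj_snd/dproj_id.
apply: (eq_dpred (dex (P := fun x y => y = f x /\ P y) (dand df dP2))) => x.
by split=> [[y [->]]//|Px]; exists (f x).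
Qed.

Lemma dfun_comp T {eT : Enc R T} U {eU : Enc R U} V {eV : Enc R V}
    (g : U -> V) (f : T -> U) : dfun g -> dfun f -> dfun (fun x => g (f x)).
Proof.
move=> dg df.
have d1 : dpred (fun p : (T * V) * U => p.2 = f p.1.1).
  apply: (dpred_proj (f := fun p : (T * V) * U => (p.1.1, p.2))
    (P := fun p : T * U => p.2 = f p.1)) => //.
  by apply: dproj_pair; [do 2!apply: dproj_fst|apply: dproj_snd]; apply: dproj_id.
have d2 : dpred (fun p : (T * V) * U => p.1.2 = g p.2).
  apply: (dpred_proj (f := fun p : (T * V) * U => (p.2, p.1.2))
    (P := fun p : U * V => p.2 = g p.1)) => //.
  by apply: dproj_pair; [apply: dproj_snd|apply/dproj_snd/dproj_fst];
     apply: dproj_id.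
apply: (eq_dpred (dex (P := fun x y => y = f x.1 /\ x.2 = g y) (dand d1 d2))) => p.
by split=> [[y [-> ]]//|Px]; exists (f p.1).
Qed.

Lemma dfun_id T {eT : Enc R T} : dfun (fun x : T => x).
Proof. exact/dproj_dfun/dproj_id. Qed.

Lemma dfun_fst T {eT : Enc R T} U {eU : Enc R U} V {eV : Enc R V}
    (f : T -> U * V) : dfun f -> dfun (fun x => (f x).1).
Proof. by apply: dfun_comp; apply/dproj_dfun/dproj_fst/dproj_id. Qed.

Lemma dfun_snd T {eT : Enc R T} U {eU : Enc R U} V {eV : Enc R V}
    (f : T -> U * V) : dfun f -> dfun (fun x => (f x).2).
Proof. by apply: dfun_comp; apply/dproj_dfun/dproj_snd/dproj_id. Qed.

Lemma dfun_coord T {eT : Enc R T} n (f : T -> 'rV[R]_n) j :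
  dfun f -> dfun (fun x => f x 0 j : R).
Proof.
move=> df; apply: (dfun_comp (g := fun v : 'rV[R]_n => v 0 j : R)) => //.
exact/dproj_dfun/dproj_coord/dproj_id.
Qed.

Lemma dfun_pair T {eT : Enc R T} U {eU : Enc R U} V {eV : Enc R V}
    (f : T -> U) (g : T -> V) :
  dfun f -> dfun g -> dfun (fun x => (f x, g x)).
Proof.
move=> df dg.
have d1 : dpred (fun p : T * (U * V) => p.2.1 = f p.1).
  apply: (dpred_proj (f := fun p : T * (U * V) => (p.1, p.2.1))
    (P := fun p : T * U => p.2 = f p.1)) => //.
  by apply: dproj_pair; do ?[apply: dproj_fst|apply: dproj_snd]; apply: dproj_id.
have d2 : dpred (fun p : T * (U * V) => p.2.2 = g p.1).
  apply: (dpred_proj (f := fun p : T * (U * V) => (p.1, p.2.2))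
    (P := fun p : T * V => p.2 = g p.1)) => //.
  by apply: dproj_pair; do ?[apply: dproj_fst|apply: dproj_snd]; apply: dproj_id.
apply: (eq_dpred (dand d1 d2)) => -[x [y z]] /=.
by split=> [[-> ->]//|[-> ->]].
Qed.

Lemma dfun_row T {eT : Enc R T} n (f : T -> 'I_n -> R) :
  (forall k, dfun (fun x => f x k)) -> dfun (fun x => \row_k f x k).
Proof.
move=> df.
have d k : dpred (fun p : T * 'rV[R]_n => p.2 0 k = f p.1 k).
  apply: (dpred_comp (f := fun p : T * 'rV[R]_n => (p.1, p.2 0 k))
    (P := fun p : T * R => p.2 = f p.1 k)); last exact: df.
  apply: dfun_pair; first exact/dfun_fst/dfun_id.
  exact/dfun_coord/dfun_snd/dfun_id.
apply: (eq_dpred (dall_fin d)) => p.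
by split=> [h|-> k]; [apply/rowP => k; rewrite mxE|rewrite mxE].
Qed.

Lemma deq T {eT : Enc R T} U {eU : Enc R U} (f g : T -> U) :
  dfun f -> dfun g -> dpred (fun x => f x = g x).
Proof.
move=> df dg; apply: (dpred_comp (f := fun x => (g x, f x))
  (P := fun p : U * U => p.2 = p.1)); first exact: dfun_pair.
exact: dfun_id.
Qed.

Lemma dlt T {eT : Enc R T} (f g : T -> R) :
  dfun f -> dfun g -> dpred (fun x => f x < g x).
Proof.
move=> df dg; apply: (dpred_comp (f := fun x => (f x, g x))
  (P := fun p : R * R => p.1 < p.2)); first exact: dfun_pair.
apply: (eq_definable (@definable_lt R M (1 + 1) (lshift 1 0) (rshift 1 0))) => w.
by rewrite /= !mxE.
Qed.

Lemma dle T {eT : Enc R T} (f g : T -> R) :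
  dfun f -> dfun g -> dpred (fun x => f x <= g x).
Proof.
move=> df dg; apply: (eq_dpred (dnot (dlt dg df))) => x.
by split=> [/negP|]; rewrite -?leNgt // leNgt => /negP.
Qed.

Lemma dfun_add T {eT : Enc R T} (f g : T -> R) :
  dfun f -> dfun g -> dfun (fun x => f x + g x).
Proof.
move=> df dg; apply: (dfun_comp (f := fun x => (f x, g x))
  (g := fun p : R * R => p.1 + p.2)); last exact: dfun_pair.
apply: (eq_definable (@definable_add R M (1 + 1 + 1) (lshift 1 (lshift 1 0))
  (lshift 1 (rshift 1 0)) (rshift _ 0))) => w.
by rewrite /= !mxE; split=> ->.
Qed.

Lemma dfun_mul T {eT : Enc R T} (f g : T -> R) :
  dfun f -> dfun g -> dfun (fun x => f x * g x).
Proof.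
move=> df dg; apply: (dfun_comp (f := fun x => (f x, g x))
  (g := fun p : R * R => p.1 * p.2)); last exact: dfun_pair.
apply: (eq_definable (@definable_mul R M (1 + 1 + 1) (lshift 1 (lshift 1 0))
  (lshift 1 (rshift 1 0)) (rshift _ 0))) => w.
by rewrite /= !mxE; split=> ->.
Qed.

Lemma dfun_cst T {eT : Enc R T} U {eU : Enc R U} (y : U) : dfun (fun _ : T => y).
Proof.
have dcst (a : R) : dfun (fun _ : U => a).
  apply: (dpred_proj (f := snd) (P := fun y => y = a)).
    exact/dproj_snd/dproj_id.
  exact: definable_point.
have d k : dpred (fun z : U => code z 0 k = code y 0 k).
  apply: deq (dcst _); apply/dfun_coord/dproj_dfun.
  by exists id.
apply: (dpred_proj (f := snd) (P := fun z => z = y)).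
  exact/dproj_snd/dproj_id.
apply: (eq_dpred (dall_fin d)) => z; split=> [h|->//].
by apply: (can_inj codeK); apply/rowP.
Qed.

Lemma dfun_opp T {eT : Enc R T} (f : T -> R) : dfun f -> dfun (fun x => - f x).
Proof.
move=> df; rewrite (_ : (fun x => _) = (fun x => -1 * f x)).
  exact/dfun_mul/df/dfun_cst.
by apply/funext => x; rewrite mulN1r.
Qed.

Lemma dfun_sub T {eT : Enc R T} (f g : T -> R) :
  dfun f -> dfun g -> dfun (fun x => f x - g x).
Proof. by move=> df dg; apply: dfun_add => //; apply: dfun_opp. Qed.

Lemma dfun_sum T {eT : Enc R T} (I : finType) (f : I -> T -> R) :
  (forall k, dfun (f k)) -> dfun (fun x => \sum_k f k x).
Proof.
move=> df; elim: (index_enum I) => [|k s IH].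
  rewrite (_ : (fun x => _) = (fun=> 0)); first exact: dfun_cst.
  by apply/funext => x; rewrite big_nil.
rewrite (_ : (fun x => _) = (fun x => f k x + \sum_(j <- s) f j x)).
  exact: dfun_add.
by apply/funext => x; rewrite big_cons.
Qed.

Lemma dfun_mulmx T {eT : Enc R T} m n (f : T -> 'rV[R]_m) (A : 'M[R]_(m, n)) :
  dfun f -> dfun (fun x => f x *m A).
Proof.
move=> df; rewrite (_ : (fun x => _) = (fun x => \row_k \sum_j f x 0 j * A j k)).
  apply: dfun_row => k; apply: dfun_sum => j.
  by apply: dfun_mul; [exact: dfun_coord|exact: dfun_cst].
by apply/funext => x; apply/rowP => k; rewrite !mxE.
Qed.

Lemma dfun_addv T {eT : Enc R T} n (f g : T -> 'rV[R]_n) :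
  dfun f -> dfun g -> dfun (fun x => f x + g x).
Proof.
move=> df dg; rewrite (_ : (fun x => _) = (fun x => \row_k (f x 0 k + g x 0 k))).
  by apply: dfun_row => k; apply: dfun_add; apply: dfun_coord.
by apply/funext => x; apply/rowP => k; rewrite !mxE.
Qed.

Lemma dfun_scalev T {eT : Enc R T} n (a : T -> R) (f : T -> 'rV[R]_n) :
  dfun a -> dfun f -> dfun (fun x => a x *: f x).
Proof.
move=> da df; rewrite (_ : (fun x => _) = (fun x => \row_k (a x * f x 0 k))).
  by apply: dfun_row => k; apply: dfun_mul => //; apply: dfun_coord.
by apply/funext => x; apply/rowP => k; rewrite !mxE.
Qed.

Lemma dfun_subv T {eT : Enc R T} n (f g : T -> 'rV[R]_n) :
  dfun f -> dfun g -> dfun (fun x => f x - g x).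
Proof.
move=> df dg; rewrite (_ : (fun x => _) = (fun x => f x + (-1) *: g x)).
  by apply: dfun_addv => //; apply: dfun_scalev => //; apply: dfun_cst.
by apply/funext => x; rewrite scaleN1r.
Qed.

(** Definable description. Outside [D] the value is the fixed point [decode 0], so that the graph is
    a union of two definable pieces and [f] is total. *)
Lemma dfun_description T {eT : Enc R T} U {eU : Enc R U} (D : T -> Prop)
    (Q : T -> U -> Prop) :
  dpred D -> dpred (fun p : T * U => Q p.1 p.2) ->
  (forall x, D x -> exists y, Q x y) ->
  (forall x y z, D x -> Q x y -> Q x z -> y = z) ->
  exists f : T -> U, [/\ dfun f, forall x, D x -> Q x (f x) &
    forall x, ~ D x -> f x = decode 0].
Proof.
move=> dD dQ exQ uQ.
have dU : dpred (fun p : U => p = decode 0) by apply: deq dfun_id (dfun_cst _).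
have F x : exists y, (D x -> Q x y) /\ (~ D x -> y = decode 0).
  have [/[dup] Dx /exQ[y Qy]|nD] := pselect (D x); first by exists y; split.
  by exists (decode 0).
have [f fP] := choice F.
exists f; split=> [|x /(proj1 (fP x))//|x /(proj2 (fP x))//].
have p1 : dproj (fun p : T * U => p.1) by apply/dproj_fst/dproj_id.
have p2 : dproj (fun p : T * U => p.2) by apply/dproj_snd/dproj_id.
apply: (eq_dpred (dor (dand (dpred_proj p1 dD) dQ)
  (dand (dpred_proj p1 (dnot dD)) (dpred_proj p2 dU)))) => -[x y] /=.
split=> [[[Dx Qy]|[nD ->]]|->].
- exact: uQ Qy (proj1 (fP x) Dx).
- by rewrite (proj2 (fP x) nD).
- have [Dx|nD] := pselect (D x); first by left; split=> //; apply: (proj1 (fP x)).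
  by right; split=> //; apply: (proj2 (fP x)).
Qed.

End Definable.

(** Follows the shape of the formula. Opaque predicates and functions are atoms, matched with
    hypotheses stating their definability, also when they take two arguments. *)
Ltac definable_step := cbv beta; match goal with
  | |- dpred _ (fun _ => True) => apply: dtrue
  | |- dpred _ (fun _ => _ /\ _) => apply: dand
  | |- dpred _ (fun _ => _ \/ _) => apply: dor
  | |- dpred _ (fun _ => ~ _) => apply: dnot
  | |- dpred _ (fun _ => exists _, _) => first [apply: dex_fin => ? | apply: dex]
  | |- dpred _ (fun _ => is_true (_ < _)) => apply: dlt
  | |- dpred _ (fun _ => is_true (_ <= _)) => apply: dle
  | |- dpred _ (fun _ => _ = _) => apply: deq
  | H : dpred _ ?P |- dpred _ ?P => exact: H
  | H : dpred _ (fun p => ?Q p.1 p.2) |- dpred _ (fun x => ?Q (@?f x) (@?g x)) =>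
      refine (dpred_comp (f := fun x => (f x, g x)) _ H)
  | H : dpred _ ?P |- dpred _ (fun x => ?P (@?f x)) => refine (dpred_comp (f := f) _ H)
  | H : dpred _ (fun p => ?Q p.1 p.2) |- dpred _ (?Q ?t) =>
      refine (dpred_comp (f := fun x => (t, x)) _ H)
  | |- dpred _ (fun _ => _ -> _) => apply: dimp
  | |- dpred _ (fun _ => forall _, _) => first [apply: dall_fin => ? | apply: dall]
  | H : dfun _ ?f |- dfun _ ?f => exact: H
  | |- dfun _ (fun x => x) => apply: dfun_id
  | |- dfun _ fst => exact (dfun_fst (dfun_id _))
  | |- dfun _ snd => exact (dfun_snd (dfun_id _))
  | |- dfun _ (fun x => (_, _)) => apply: dfun_pair
  | |- dfun _ (fun x => _.1) => apply: dfun_fst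
  | |- dfun _ (fun x => _.2) => apply: dfun_snd
  | |- dfun _ (fun x => ?c) => apply: dfun_cst
  | H : dfun _ ?h |- dfun _ (fun x => ?h (@?f x)) => refine (dfun_comp H _)
  | H : dfun _ (fun p => ?h p.1 p.2) |- dfun _ (fun x => ?h (@?f x) (@?g x)) =>
      refine (dfun_comp (f := fun x => (f x, g x)) H _)
  | |- dfun _ (fun x => fun_of_matrix _ 0 _) => apply: dfun_coord
  | |- dfun _ (fun x => _ - _) => first [apply: dfun_sub | apply: dfun_subv]
  | |- dfun _ (fun x => _ + _) => first [apply: dfun_add | apply: dfun_addv]
  | |- dfun _ (fun x => _ * _) => apply: dfun_mul
  | |- dfun _ (fun x => - _) => apply: dfun_opp
  | |- dfun _ -%R => apply: (dfun_opp (dfun_id _))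
  | |- dfun _ (fun x => _ *: _) => apply: dfun_scalev
  | |- dfun _ (fun x => _ *m _) => apply: dfun_mulmx
  end.
Ltac definability := repeat definable_step.

(** * One-variable o-minimality *)

Section OneVariable.
Variables (R : rcfType) (M : ominimal R).
Implicit Types (a b u v x y t : R).

Lemma dpred_intervals (S : R -> Prop) : dpred M S ->
  exists s : seq (interval R), forall x, S x <-> exists2 J, J \in s & x \in J.
Proof.
move=> /ominimality[s sP]; exists s => x.
by rewrite -sP /= mxE.
Qed.

Lemma itv_convex (J : interval R) x y z :
  x \in J -> y \in J -> x <= z -> z <= y -> z \in J.
Proof.
case: J => [[bl l|bl] [br r|br]]; rewrite !in_itv /= => + + xz zy;
  case: bl; case: br => //=; lra.
Qed.

(** Plays the role of holding generically: finitely many such properties can be obtained together by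
    passing to smaller and smaller intervals. *)
Definition has_itv (S : R -> Prop) a b : Prop :=
  exists u v, [/\ a <= u, u < v, v <= b & forall x, u < x < v -> S x].

Lemma has_itv_widen (S : R -> Prop) a b c d :
  a <= c -> d <= b -> has_itv S c d -> has_itv S a b.
Proof.
move=> ac db [u [v [au uv vb uvS]]]; exists u, v; split=> //; lra.
Qed.

(** An interval of the decomposition with two distinct points contains everything between them; if
    there is none, each contributes at most one point. *)
Lemma finite_or_itv (S : R -> Prop) : dpred M S ->
  (exists u v, u < v /\ forall x, u < x < v -> S x) \/
  exists l : seq R, forall x, S x -> x \in l.
Proof.
move=> /dpred_intervals[s sP].
have [big|small] := pselect (exists J x y, [/\ J \in s, x \in J, y \in J & x < y]).
  case: big => J [x [y [Js xJ yJ xy]]]; left; exists x, y; split=> // z /andP[xz zy].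
  by apply/sP; exists J => //; apply: itv_convex xJ yJ _ _; exact: ltW.
right; have [l lP] : exists l : seq R, forall x J, J \in s -> x \in J -> x \in l.
  have {sP} : forall J x y, J \in s -> x \in J -> y \in J -> x = y.
    move=> J x y Js xJ yJ; have [xy|yx|//] := ltgtP x y; exfalso; apply: small.
      by exists J, x, y.
    by exists J, y, x.
  elim: s {small} => [|J s IH] h; first by exists [::].
  have [|l lP] := IH; first by move=> K x y Ks; apply: h; rewrite inE Ks orbT.
  have [[z zJ]|nJ] := pselect (exists z, z \in J).
    exists (z :: l) => x K; rewrite !inE => /predU1P[->|Ks] xK.
      by rewrite (h J x z) ?inE ?eqxx.
    by rewrite (lP x K) ?orbT.
  exists l => x K; rewrite inE => /predU1P[->|]; last exact: lP.
  by move=> xJ; case: nJ; exists x.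
by exists l => x /sP[J Js xJ]; apply: lP xJ.
Qed.

Lemma itv_avoid (l : seq R) a b : a < b ->
  exists u v, [/\ a <= u, u < v, v <= b & forall x, u < x < v -> x \notin l].
Proof.
elim: l a b => [|z l IH] a b ab; first by exists a, b.
have [u [v [au uv vb h]]] := IH a b ab.
have [zm|mz] := lerP z ((u + v) / 2).
  exists ((u + v) / 2), v; split=> //; try lra.
  move=> x /andP[x1 x2]; rewrite inE negb_or h ?andbT; lra.
exists u, ((u + v) / 2); split=> //; try lra.
move=> x /andP[x1 x2]; rewrite inE negb_or h ?andbT; lra.
Qed.

Lemma itv_subset u v a b : u < v ->
  (forall x, u < x < v -> a < x < b) -> a <= u /\ v <= b.
Proof.
move=> uv m; split; rewrite leNgt; apply/negP => h.
  have := m (Num.min ((u + a) / 2) ((u + v) / 2)).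
  by rewrite /Order.min; case: ifP; lra.
have := m (Num.max ((v + b) / 2) ((u + v) / 2)).
by rewrite /Order.max; case: ifP; lra.
Qed.

Lemma itv_dichotomy (S : R -> Prop) a b : dpred M S -> a < b ->
  has_itv S a b \/ has_itv (fun x => ~ S x) a b.
Proof.
move=> dS ab; have dSab : dpred M (fun x => S x /\ a < x /\ x < b) by definability.
have [[u [v [uv uvS]]]|[l lP]] := finite_or_itv dSab.
  have [|au vb] := @itv_subset u v a b uv; first by move=> x /uvS[_ [-> ->]].
  by left; exists u, v; split=> // x /uvS[].
right; have [u [v [au uv vb h]]] := itv_avoid l ab.
exists u, v; split=> // x xuv Sx; have := h x xuv.
by rewrite lP //; do !split=> //; lra.
Qed.

(** Pigeonhole for definable covers: if the first set contains no subinterval, its complement does,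
    and there the remaining sets form a cover. *)
Lemma itv_cover (Y : eqType) (l : seq Y) (S : Y -> R -> Prop) a b :
  a < b -> (forall k, k \in l -> dpred M (S k)) ->
  (forall x, a < x < b -> exists2 k, k \in l & S k x) ->
  exists2 k, k \in l & has_itv (S k) a b.
Proof.
elim: l a b => [|z l IH] a b ab dS cov.
  have [|k] := cov ((a + b) / 2); first lra.
  by rewrite in_nil.
have [zI|[u [v [au uv vb h]]]] := itv_dichotomy (dS z (mem_head _ _)) ab.
  by exists z => //; rewrite mem_head.
have [k kl|x xuv|k kl kI] := IH u v uv.
- by apply: dS; rewrite inE kl orbT.
- have [|k] := cov x; first lra.
  rewrite inE => /predU1P[->/(h _ xuv)//|]; by exists k.
- by exists k; [rewrite inE kl orbT|apply: has_itv_widen kI].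
Qed.

Lemma itv_cover2 (S T : R -> Prop) a b : a < b -> dpred M S -> dpred M T ->
  (forall x, a < x < b -> S x \/ T x) -> has_itv S a b \/ has_itv T a b.
Proof.
move=> ab dS dT cov.
have [||[] _ h] := @itv_cover bool [:: true; false] (fun c => if c then S else T) a b ab.
- by case.
- by move=> x /cov[]; [exists true|exists false].
- by left.
- by right.
Qed.

(** By convexity, each interval of the decomposition either contains or misses a whole right
    neighbourhood of [x]; the smallest of the finitely many radii serves. *)
Lemma right_germ (S : R -> Prop) x : dpred M S ->
  exists2 e, 0 < e & (forall y, x < y < x + e -> S y) \/
                    (forall y, x < y < x + e -> ~ S y).
Proof.
move=> /dpred_intervals[s sP].
have [e e0 h] : exists2 e, 0 < e & forall J, J \in s ->
    (forall y, x < y < x + e -> y \in J) \/ (forall y, x < y < x + e -> y \notin J).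
  elim: s {sP} => [|J s [e e0 IH]]; first by exists 1.
  have [[z zx zJ]|nz] := pselect (exists2 z, x < z & z \in J).
    have [[w wx wJ]|nw] := pselect (exists2 w, x < w & w < z /\ w \notin J); last first.
      exists (Num.min e (z - x)); first by rewrite lt_min e0; lra.
      move=> K; rewrite inE => /predU1P[->|/IH[]h]; [left|left|right] => y;
        move=> /andP[xy]; rewrite /Order.min; case: ifP => c yx; try (by apply: h; lra).
        by apply: contrapT => /negP yJ; apply: nw; exists y => //; split=> //; lra.
      by apply: contrapT => /negP yJ; apply: nw; exists y => //; split=> //; lra.
    exists (Num.min e (w - x)); first by rewrite lt_min e0; lra.
    move=> K; rewrite inE => /predU1P[->|/IH[]h]; [right|left|right] => y;
      move=> /andP[xy]; rewrite /Order.min; case: ifP => c yx; try (by apply: h; lra).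
      by apply/negP => yJ; case: wJ => wz /negP; apply; apply: itv_convex yJ zJ _ _; lra.
    by apply/negP => yJ; case: wJ => wz /negP; apply; apply: itv_convex yJ zJ _ _; lra.
  exists e => // K; rewrite inE => /predU1P[->|/IH//]; right=> y xy.
  by apply/negP => yJ; apply: nz; exists y => //; lra.
exists e => //.
have [[J Js Jx]|nJ] := pselect (exists2 J, J \in s & forall y, x < y < x + e -> y \in J).
  by left=> y /Jx yJ; apply/sP; exists J.
right=> y yx /sP[J Js yJ]; have [Jx|/(_ _ yx)] := h J Js; last by rewrite yJ.
by apply: nJ; exists J.
Qed.

Definition is_lub (S : R -> Prop) c : Prop :=
  (forall x, S x -> x <= c) /\ (forall d, d < c -> exists2 x, S x & d < x).

Lemma is_lub_uniq (S : R -> Prop) c d : is_lub S c -> is_lub S d -> c = d.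
Proof.
move=> [c1 c2] [d1 d2]; have [cd|dc|//] := ltgtP c d.
  by have [x /c1] := d2 _ cd; lra.
by have [x /d1] := c2 _ dc; lra.
Qed.

(** Completeness restricted to definable sets: a finite union of intervals has as supremum the
    largest right endpoint among its nonempty members. *)
Lemma definable_sup (S : R -> Prop) : dpred M S ->
  (exists x, S x) -> (exists b, forall x, S x -> x <= b) -> exists c, is_lub S c.
Proof.
move=> /dpred_intervals[s sP].
suff h : (exists x, exists2 J, J \in s & x \in J) ->
  (exists b, forall x J, J \in s -> x \in J -> x <= b) ->
  exists c, is_lub (fun x => exists2 J, J \in s & x \in J) c.
  move=> [x /sP Sx] [b Sb]; have [||c [c1 c2]] := h.
  - by exists x.
  - by exists b => y J Js yJ; apply/Sb/sP; exists J.
  - by exists c; split=> [y /sP/c1//|d /c2[y /sP Sy dy]]; exists y.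
elim: s {sP} => [[x []//]|J s IH] + [b bP].
have bs : exists b, forall x J, J \in s -> x \in J -> x <= b.
  by exists b => x K Ks; apply: bP; rewrite inE Ks orbT.
have lubJ z : z \in J -> exists c, is_lub (fun x => x \in J) c.
  have bJ x : x \in J -> x <= b by apply: bP; rewrite mem_head.
  case: J bJ {bP} => bl [br r|br] bJ zJ; last first.
    have [w zw bw] : exists2 w, z <= w & b < w.
      by have [zb|bz] := lerP z b; [exists (b + 1)|exists z]; lra.
    suff /bJ : w \in Interval bl (BInfty _ br) by lra.
    by move: zJ; rewrite !in_itv /= => /andP[+ ->]; case: bl {bJ} => [[] l|[]] //=; lra.
  exists r; split=> [x|d dr].
    by rewrite in_itv /= => /andP[_]; case: br {bJ zJ} => //= /ltW.
  have [dz|zd] := ltP d z; first by exists z.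
  exists ((d + r) / 2); last by lra.
  move: zJ; rewrite !in_itv => /andP[h1 h2]; apply/andP; split.
    by case: bl h1 {bJ} => [[] l|[]] //=; lra.
  by case: br h2 {bJ} => /=; lra.
have memU x : (exists2 K, K \in J :: s & x \in K) <->
    x \in J \/ exists2 K, K \in s & x \in K.
  split=> [[K]|[xJ|[K Ks xK]]]; first 1 last.
  - by exists J => //; rewrite mem_head.
  - by exists K => //; rewrite inE Ks orbT.
  by rewrite inE => /predU1P[->|Ks] xK; [left|right; exists K].
have ext c : is_lub (fun x => x \in J \/ exists2 K, K \in s & x \in K) c ->
    exists c, is_lub (fun x => exists2 K, K \in J :: s & x \in K) c.
  by move=> [c1 c2]; exists c; split=> [x /memU/c1//|d /c2[x /memU]]; exists x.
have [[z zJ]|nJ] := pselect (exists z, z \in J); last first.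
  move=> [x /memU[xJ|h]]; first by case: nJ; exists x.
  have [c [c1 c2]] := IH (ex_intro _ x h) bs; apply: (ext c).
  split=> [y [yJ|/c1//]|d /c2[y ys dy]]; first by case: nJ; exists y.
  by exists y => //; right.
have [c [c1 c2]] := lubJ z zJ => _.
have [hs|ns] := pselect (exists x, exists2 K, K \in s & x \in K); last first.
  apply: (ext c); split=> [y [/c1//|h]|d /c2[y ys dy]].
    by case: ns; exists y.
  by exists y => //; left.
have [e [e1 e2]] := IH hs bs.
have [ce|ec] := lerP c e.
  apply: (ext e); split=> [y [/c1 yc|/e1//]|d /e2[y ys dy]]; first lra.
  by exists y => //; right.
apply: (ext c); split=> [y [/c1//|/e1 ye]|d /c2[y ys dy]]; first lra.
by exists y => //; left.
Qed.

End OneVariable.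

(** * Uniformity on subintervals, and constancy from vanishing derivatives *)

Section UniformRadius.
Variables (R : rcfType) (M : ominimal R).
Implicit Types (a b u v x y t : R).

(* A Baire-type principle: the least upper bounds of the fibres either take a
   single value on an interval, or fill an interval (u, v), and then the fibres
   of only finitely many points could fail to produce the uniform bound. *)
Lemma uniform_radius (D : R -> R -> Prop) a b :
  a < b -> dpred M (fun p : R * R => D p.1 p.2) ->
  (forall t (d e : R), 0 < e -> e <= d -> D t d -> D t e) ->
  (forall t, a < t < b -> exists2 d : R, 0 < d & D t d) ->
  exists2 e, 0 < e & has_itv (fun t => D t e) a b.
Proof.
move=> ab dD Ddown Dex.
(* The cut at 1 bounds the fibre, so its supremum exists even when every radius is admissible. The
   least upper bound is spelled out to be visibly definable. *)
pose L t u := (forall d : R, 0 < d /\ d < 1 /\ D t d -> d <= u) /\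
  (forall c : R, c < u -> exists d : R, (0 < d /\ d < 1 /\ D t d) /\ c < d).
have Llub t u : L t u <-> is_lub (fun d => 0 < d /\ d < 1 /\ D t d) u.
  split=> -[h1 h2]; split=> // c /h2.
    by case=> d [? ?]; exists d.
  by case=> d ? ?; exists d.
have dL : dpred M (fun p : R * R => L p.1 p.2) by rewrite /L; definability.
have LD t u e : L t u -> 0 < e -> e < u -> D t e.
  move=> [_ h] e0 /h[d [[d0 [_ Dd]] ed]]; apply: Ddown Dd => //; exact: ltW.
have Lex t : a < t < b -> exists2 u, 0 < u & L t u.
  move=> /Dex[d d0 Dd]; pose d' := Num.min d (1 / 2).
  have d'0 : 0 < d' by rewrite lt_min d0; lra.
  have d'1 : d' < 1 by rewrite gt_min; apply/orP; right; lra.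
  have Dd' : D t d' by apply: Ddown Dd; rewrite // ge_min lexx.
  have [|||u hu] := @definable_sup R M (fun d => 0 < d /\ d < 1 /\ D t d).
  - by definability.
  - by exists d'.
  - by exists 1 => x [_ []]; lra.
  - exists u; last exact/Llub.
    by have := proj1 hu d' (conj d'0 (conj d'1 Dd')); lra.
have dIm : dpred M (fun u => exists t, (a < t /\ t < b) /\ (0 < u /\ L t u)).
  by definability.
have [[u [v [uv h]]]|[l lP]] := finite_or_itv dIm; last first.
  have [||u ul [p [q [ap pq qb h]]]] :=
      @itv_cover _ M R l (fun u t => 0 < u /\ L t u) a b ab.
  - by move=> u _; definability.
  - move=> t abt; have [u u0 Ltu] := Lex t abt.
    by exists u => //; apply: lP; exists t; split=> //; apply/andP.
  - have [|u0 _] := h ((p + q) / 2); first lra.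
    exists (u / 2); first lra.
    by exists p, q; split=> // t /h[_ Ltu]; apply: LD Ltu _ _; lra.
have u0 : 0 <= u.
  rewrite leNgt; apply/negP => u0; pose w := Num.min (u / 2) ((u + v) / 2).
  have : u < w < v /\ w < 0 by rewrite /w /Order.min; case: ifP; lra.
  by case=> /h[t [_ [w0 _]]]; lra.
(* Each [w] in the upper half of [(u, v)] is the supremum of the fibre over some [t], for which this
   radius is then admissible. Were there finitely many such [t], one of them would have two
   different suprema. *)
exists ((u + v) / 2); first lra.
have dDe : dpred M (fun t => D t ((u + v) / 2) /\ a < t /\ t < b) by definability.
have [[p [q [pq pqD]]]|[l lP]] := finite_or_itv dDe.
  have [|ap qb] := @itv_subset _ p q a b pq; first by move=> x /pqD[_ [-> ->]].
  by exists p, q; split=> // x /pqD[].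
have [|||k kl [p [q [_ pq _ pqL]]]] := @itv_cover _ M R l L ((u + v) / 2) v.
- lra.
- by move=> k _; definability.
- move=> w uwv; have [|t [tab [w0 Ltw]]] := h w; first lra.
  exists t => //; apply: lP; split=> //; apply: LD Ltw _ _; lra.
- have /Llub L1 := pqL ((p + q) / 2) ltac:(lra).
  have /Llub L2 := pqL ((p + 2 * q) / 3) ltac:(lra).
  have := is_lub_uniq L1 L2; lra.
Qed.

(* Replaces the mean value theorem, which fails over R for functions that are
   not definable. *)
Lemma flat_const (f : R -> R) a b : a <= b -> dfun M f ->
  (forall s e, a <= s -> s < b -> 0 < e -> exists2 d, 0 < d &
     forall t, s < t -> t < s + d -> t <= b -> `|f t - f s| <= e * (t - s)) ->
  (forall s e, a < s -> s <= b -> 0 < e -> exists2 d, 0 < d &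
     forall t, s - d < t -> t < s -> a <= t -> `|f t - f s| <= e) ->
  f b = f a.
Proof.
move=> ab df flat lcont.
suff h e : 0 < e -> `|f b - f a| <= e * (b - a).
  apply/eqP; rewrite -subr_eq0 -normr_le0 leNgt; apply/negP => n0.
  have [ba|ba] := eqVneq (b - a) 0.
    by have := h 1 ltr01; rewrite ba mulr0; lra.
  have ba0 : 0 < b - a by rewrite lt_neqAle eq_sym ba subr_ge0.
  have := h (`|f b - f a| / (b - a) / 2); rewrite mulrAC divfK // => /(_ _).
  by rewrite !divr_gt0 // => /(_ isT); lra.
move=> e0; pose ok s := - (e * (s - a)) <= f s - f a /\ f s - f a <= e * (s - a).
have okE s : ok s <-> `|f s - f a| <= e * (s - a).
  by rewrite ler_norml; split=> [[-> ->]|/andP].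
(* Continuous induction: the bound of slope [e] passes to the supremum of [T] by left continuity,
   and beyond it by flatness on the right. *)
pose T t := (a <= t /\ t <= b) /\ forall s, a <= s -> s <= t -> ok s.
have dT : dpred M T by rewrite /T /ok; definability.
have oka : ok a by rewrite /ok; lra.
have Ta : T a by split=> [|s as_ sa]; [lra|rewrite (_ : s = a) //; lra].
have [|c [c1 c2]] := definable_sup dT (ex_intro _ a Ta).
  by exists b => x [[]].
have ac := c1 _ Ta.
have cb : c <= b by rewrite leNgt; apply/negP => /c2[x [[]]]; lra.
have below s : a <= s -> s < c -> ok s.
  by move=> as_ /c2[t [_ h] st]; apply: h => //; lra.
have okc : ok c.
  have [->//|ca] := eqVneq c a; have {ac}ac : a < c by rewrite lt_neqAle eq_sym ca.
  apply/okE; rewrite leNgt; apply/negP => h.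
  have [|d d0 hd] := lcont c ((`|f c - f a| - e * (c - a)) / 2) ac cb; first lra.
  pose s := Num.max ((a + c) / 2) (c - d / 2).
  have [s1 s2 s3] : [/\ a <= s, s < c & c - d < s].
    by rewrite /s /Order.max; case: ifP; split; lra.
  have /okE := below s s1 s2; have := hd s s3 s2 s1.
  have := ler_normD (f c - f s) (f s - f a); rewrite addrA subrK (distrC (f c) (f s)).
  have : e * (s - a) <= e * (c - a) by rewrite ler_pM2l //; lra.
  lra.
have Tc : T c.
  split=> [|s as_ sc]; first lra.
  by have [->//|sc'] := eqVneq s c; apply: below; rewrite // lt_neqAle sc'.
have [<-|cb'] := eqVneq c b; first exact/okE.
have [|d d0 hd] := flat c e ac _ e0; first by rewrite lt_neqAle cb'.
pose t := Num.min ((c + b) / 2) (c + d / 2).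
have cb2 : c < b by rewrite lt_neqAle cb'.
have [t1 t2 t3] : [/\ c < t, t < c + d & t <= b].
  by rewrite /t /Order.min; case: ifP; split; lra.
have : T t; last by move/c1; lra.
split=> [|s as_ st]; first lra.
have [sc|cs] := lerP s c; first by apply Tc.
have := hd s cs; move/okE: okc => okc /(_ _ _); move: okc.
rewrite !ler_norml => /andP[k1 k2] /(_ ltac:(lra) ltac:(lra)) /andP[k3 k4].
by rewrite /ok; lra.
Qed.

End UniformRadius.

(** * Absence of infinite slopes *)

Section Slopes.
Variables (R : rcfType) (M : ominimal R).
Implicit Types (a b u v x y t : R).

(* Right-Lipschitz at x, with absolute values unfolded so that the condition is
   visibly definable. *)
Definition rlip (f : R -> R) x : Prop := exists C e : R, 0 < e /\
  forall y, x < y -> y < x + e -> - (C * (y - x)) <= f y - f x /\ f y - f x <= C * (y - x).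

(* Such an f would be strictly increasing on some interval, with an inverse of
   zero right derivative. *)
Lemma no_infinite_slope (f : R -> R) a b : a < b -> dfun M f ->
  ~ (forall x, a < x < b -> forall C : R, exists2 e, 0 < e &
       forall y, x < y < x + e -> C * (y - x) < f y - f x).
Proof.
move=> ab df steep.
pose D x (d : R) := forall y, x < y -> y < x + d -> y - x < f y - f x.
have dD : dpred M (fun p : R * R => D p.1 p.2) by rewrite /D; definability.
have [|x xab|e e0 [u [v0 [au uv0 v0b h]]]] := uniform_radius ab dD.
- by move=> x d e e0 ed h y xy ye; apply: h => //; lra.
- have [e e0 h] := steep x xab 1; exists e => // y xy ye.
  by have := h y; rewrite mul1r; apply; rewrite xy.
(* The interval is made shorter than the uniform radius, so that the slope bound applies to any two
   of its points. *)
pose v := Num.min v0 (u + e / 2).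
have [uv vv0 ve] : [/\ u < v, v <= v0 & v < u + e].
  by rewrite /v /Order.min; case: ifP; split; lra.
have inc x y : u < x -> x < y -> y < v -> y - x < f y - f x.
  by move=> ux xy yv; apply: h => //; lra.
have dIm : dpred M (fun w => exists x, (u < x /\ x < v) /\ f x = w) by definability.
have [[p [q [pq pqf]]]|[l lP]] := finite_or_itv dIm; last first.
  have [||k kl [p [q [up pq qv h2]]]] := @itv_cover _ M R l (fun w x => f x = w) u v uv.
  - by move=> k _; definability.
  - move=> x /andP[ux xv]; exists (f x) => //; apply: lP; by exists x.
  - have := inc ((2 * p + q) / 3) ((p + 2 * q) / 3).
    by rewrite !h2; lra.
have [||||g [dg gP _]] := @dfun_description R M R _ R _ (fun w => p < w /\ w < q)
    (fun w x => (u < x /\ x < v) /\ f x = w).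
- by definability.
- by definability.
- by move=> w pwq; have [|x] := pqf w; [apply/andP|exists x].
- move=> w x y _ [xuv fx] [yuv fy].
  have [xy|yx|//] := ltgtP x y.
    by have := inc x y; lra.
  by have := inc y x; lra.
have gmono s t : p < s -> s < t -> t < q -> 0 < g t - g s < t - s.
  move=> ps st tq.
  have [|su fs] := gP s; first lra.
  have [|tu ft] := gP t; first lra.
  have [gst|gts|gst] := ltgtP (g s) (g t).
  - by have := inc (g s) (g t); lra.
  - by have := inc (g t) (g s); lra.
  - by move: fs; rewrite gst ft; lra.
have [|_ f1] := gP ((2 * p + q) / 3); first lra.
have [|_ f2] := gP ((p + 2 * q) / 3); first lra.
suff gE : g ((p + 2 * q) / 3) = g ((2 * p + q) / 3) by move: f2; rewrite gE f1; lra.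
apply: (flat_const _ dg).
- lra.
- move=> s e' s1 s2 e'0.
  have [|su fs] := gP s; first lra.
  (* A slope of [f] above the inverse of [e'] is a slope of the inverse function [g] below [e']. *)
  have [|d d0 hd] := steep (g s) _ e'^-1; first lra.
  exists d => // t st td tb.
  have [|tu ft] := gP t; first lra.
  have := gmono s t; have := hd (g t).
  rewrite ltr_pdivrMl // ft fs ler_norml => h1 h2.
  have {}h2 : 0 < g t - g s < t - s by apply: h2; lra.
  by have := h1 ltac:(lra); lra.
- move=> s e' s1 s2 e'0; exists e' => // t ts sst at_.
  have := gmono t s; rewrite ler_norml; lra.
Qed.

End Slopes.

(** * Generic right-Lipschitz regularity and definable choice *)

Section Choice.
Variables (R : rcfType) (M : ominimal R).
Implicit Types (a b u v x y t : R).

(** Where the property fails throughout an interval, one-sided germs show that [f] leaves every cone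
    on the right of every point. The sign of its increments is constant on right germs, hence the
    same at all points of a subinterval, and there [f] or its opposite has infinite slope
    everywhere. *)
Lemma rlip_generic (f : R -> R) a b : a < b -> dfun M f -> has_itv (rlip f) a b.
Proof.
move=> ab df.
have drlip : dpred M (rlip f) by rewrite /rlip; definability.
have [//|[u [v [au uv vb bad]]]] := itv_dichotomy drlip ab; exfalso.
have steep x (C : R) : u < x < v -> exists2 e, 0 < e &
    forall y, x < y < x + e -> C * (y - x) < f y - f x \/ C * (y - x) < f x - f y.
  move=> xuv; have [|e e0 [h|h]] := @right_germ R M (fun y =>
    - (C * (y - x)) <= f y - f x /\ f y - f x <= C * (y - x)) x.
  - by definability.
  - case: (bad x xuv); exists C, e; split=> // y xy ye.
    by apply: h; rewrite xy.
  - exists e => // y /h nh; apply: contrapT => /not_orP[/negP h1 /negP h2].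
    by apply: nh; move: h1 h2; rewrite -!leNgt; lra.
pose S (g : R -> R) x := exists e : R, 0 < e /\ forall y, x < y -> y < x + e -> g x < g y.
have SP (g : R -> R) : dfun M g -> (forall x y, `|g x - g y| = `|f x - f y|) ->
    ~ has_itv (S g) u v.
  move=> dg gf [p [q [up pq qv h]]]; apply: (no_infinite_slope pq dg) => x xpq C.
  have [e [e0 he]] := h x xpq; have [|e' e'0 he'] := steep x (Num.max C 0); first lra.
  exists (Num.min e e'); first by rewrite lt_min e0.
  move=> y /andP[xy]; rewrite -ltrBlDl lt_min !ltrBlDl => /andP[ye ye'].
  have gxy := he y xy ye; have := he' y; rewrite xy => /(_ ye').
  have := gf y x; rewrite [X in X = _]gtr0_norm ?subr_gt0 // => ->.
  have CC : C * (y - x) <= Num.max C 0 * (y - x).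
    by rewrite ler_pM2r ?subr_gt0 // le_max lexx.
  by case; have := ler_norm (f y - f x); have := ler_norm (f x - f y);
    rewrite (distrC (f x)); lra.
have dS g : dfun M g -> dpred M (S g) by move=> dg; rewrite /S; definability.
have dNf : dfun M (fun x => - f x) by definability.
have [x xuv||] := itv_cover2 uv (dS _ df) (dS _ dNf).
- have [|e e0 [h|h]] := @right_germ R M (fun y => f x < f y) x.
  + by definability.
  + by left; exists e; split=> // y xy ye; apply: h; rewrite xy.
  + have [e' e'0 he'] := steep x 0 xuv.
    right; exists (Num.min e e'); split; first by rewrite lt_min e0.
    move=> y xy; rewrite -ltrBlDl lt_min !ltrBlDl => /andP[ye ye'].
    have := h y; rewrite xy ye => /(_ isT); have := he' y; rewrite xy ye' => /(_ isT).
    by rewrite mul0r => -[]; lra.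
- exact: SP.
- by apply: SP => // x y; rewrite -opprD normrN.
Qed.

Lemma itv_all_fin (I : finType) (S : I -> R -> Prop) a b : a < b ->
  (forall k u v, u < v -> has_itv (S k) u v) -> has_itv (fun x => forall k, S k x) a b.
Proof.
move=> ab h.
suff [u [v [au uv vb uvS]]] : has_itv (fun x => forall k, k \in enum I -> S k x) a b.
  by exists u, v; split=> // x /uvS xS k; apply: xS; rewrite mem_enum.
elim: (enum I) => [|k s [u [v [au uv vb uvS]]]]; first by exists a, b; split.
have [p [q [up pq qv pqS]]] := h k u v uv.
exists p, q; split=> //; try lra.
move=> x xpq j; rewrite inE => /predU1P[->|]; first exact: pqS.
by apply: uvS; lra.
Qed.

(** The choice function need only be correct on a subinterval, since its uses shrink the interval
    anyway. *)
Definition has_choice T {eT : Enc R T} : Prop := forall (S : R -> T -> Prop) a b,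
  a < b -> dpred M (fun p : R * T => S p.1 p.2) ->
  (forall t, a < t < b -> exists z, S t z) ->
  exists f, dfun M f /\ has_itv (fun t => S t (f t)) a b.

Arguments has_choice T {eT}.

Lemma has_choice_prod T {eT : Enc R T} U {eU : Enc R U} :
  has_choice T -> has_choice U -> has_choice (T * U).
Proof.
move=> cT cU S a b ab dS exS.
have [||f [df [u [v [au uv vb h]]]]] := cT (fun t z => exists w, S t (z, w)) a b ab.
- by definability.
- by move=> t /exS[[x y] ?]; exists x, y.
have [|g [dg [p [q [up pq qv h2]]]]] := cU (fun t w => S t (f t, w)) u v uv _ h.
  by definability.
exists (fun t => (f t, g t)); split; first by definability.
by exists p, q; split=> //; lra.
Qed.

Lemma has_choice_image T {eT : Enc R T} U {eU : Enc R U} (e : T -> U) (e' : U -> T) :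
  dfun M e -> cancel e' e -> has_choice T -> has_choice U.
Proof.
move=> de e'K cT S a b ab dS exS.
have [||f [df h]] := cT (fun t z => S t (e z)) a b ab.
- by definability.
- by move=> t /exS[y Sy]; exists (e' y); rewrite e'K.
by exists (fun t => e (f t)); split=> //; definability.
Qed.

(** Nonnegativity provides infima. Either the least element of the fibre exists on a subinterval and
    is chosen, or the infimum is generically not attained; the fibre then contains an interval just
    to the right of its infimum, of a length [e] that can be made uniform, and the point at distance
    [e / 2] is chosen. *)
Lemma has_choice_nonneg (S : R -> R -> Prop) a b :
  a < b -> dpred M (fun p : R * R => S p.1 p.2) ->
  (forall t, a < t < b -> exists y, 0 <= y /\ S t y) ->
  exists f, dfun M f /\ has_itv (fun t => S t (f t)) a b.
Proof.
move=> ab dS exS.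
pose least t y := (0 <= y /\ S t y) /\ forall z, 0 <= z -> S t z -> y <= z.
have dleast : dpred M (fun p : R * R => least p.1 p.2) by rewrite /least; definability.
have [||[u [v [au uv vb h]]]|[u [v [au uv vb h]]]] :=
    @itv_dichotomy _ M (fun t => exists y, least t y) a b.
- by definability.
- by [].
- have [||||f [df fP _]] := @dfun_description R M R _ R _ (fun t => u < t /\ t < v) least.
  + by definability.
  + by definability.
  + by move=> t [ut tv]; apply: h; rewrite ut.
  + move=> t y z _ [[y0 Sy] yle] [[z0 Sz] zle].
    by apply/eqP; rewrite eq_le yle ?zle.
  exists f; split=> //; exists u, v; split=> // t /andP[ut tv].
  by case: (fP t (conj ut tv)) => -[].
pose inf t c := (forall z, 0 <= z -> S t z -> c <= z) /\
  forall d : R, c < d -> exists z, (0 <= z /\ S t z) /\ z < d.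
have dinf : dpred M (fun p : R * R => inf p.1 p.2) by rewrite /inf; definability.
have infU t c d : inf t c -> inf t d -> c = d.
  move=> [c1 c2] [d1 d2]; have [cd|dc|//] := ltgtP c d.
    by have [z [[z0 Sz]]] := c2 _ cd; have := d1 z z0 Sz; lra.
  by have [z [[z0 Sz]]] := d2 _ dc; have := c1 z z0 Sz; lra.
have infE t : u < t < v -> exists c, inf t c.
  move=> tuv; have [|z [z0 Sz]] := exS t; first lra.
  have [|||c [c1 c2]] := @definable_sup _ M (fun x => x <= 0 /\ S t (- x)).
  - by definability.
  - by exists (- z); rewrite opprK; split=> //; lra.
  - by exists 0 => x [].
  exists (- c); split=> [w w0 Sw|d cd].
    by have : - w <= c; [apply: c1; rewrite opprK; split=> //; lra|lra].
  have [|x [x0 Sx] dx] := c2 (- d); first lra.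
  by exists (- x); split; [split|]; rewrite //; lra.
pose D t (d : R) := exists c, inf t c /\ forall z, c < z -> z < c + d -> S t z.
have dD : dpred M (fun p : R * R => D p.1 p.2) by rewrite /D; definability.
have [|t tuv|e e0 [p [q [up pq qv pqD]]]] := uniform_radius uv dD.
- by move=> t d e e0 ed [c [ic h2]]; exists c; split=> // z cz ze; apply: h2 => //; lra.
- have [c ic] := infE t tuv.
  have [|e e0 [h2|h2]] := @right_germ _ M (S t) c; first by definability.
    by exists e => //; exists c; split=> // z cz ze; apply: h2; rewrite cz.
  (* If the fibre missed a right neighbourhood of its infimum [c], then [c] itself would belong to
     it, and least elements have been excluded. *)
  case: (h t tuv); exists c; have [c1 c2] := ic.
  have [|z [[z0 Sz] zc]] := c2 (c + e); first lra.
  have cz := c1 z z0 Sz; split=> //.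
  have [<-//|zc'] := eqVneq z c; case: (h2 z) => //.
  by rewrite zc andbT lt_neqAle eq_sym zc'.
have [||||f [df fP _]] := @dfun_description R M R _ R _ (fun t => p < t /\ t < q)
    (fun t y => exists c, inf t c /\ y = c + e / 2).
- by definability.
- by definability.
- move=> t tpq; have [|c ic] := infE t; first lra.
  by exists (c + e / 2), c.
- by move=> t y z _ [c [ic ->]] [d [id ->]]; rewrite (infU _ _ _ ic id).
exists f; split=> //; exists p, q; split=> //; try lra.
move=> t tpq; have [|c [ic ->]] := fP t; first lra.
have [d [id h2]] := pqD t tpq; apply: h2; rewrite (infU _ _ _ ic id); lra.
Qed.

Lemma has_choice_real : has_choice R.
Proof.
move=> S a b ab dS exS.
have [|||[u [v [au uv vb h]]]|[u [v [au uv vb h]]]] := @itv_cover2 _ M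
  (fun t => exists y, 0 <= y /\ S t y) (fun t => exists y, 0 <= y /\ S t (- y)) a b ab.
- by definability.
- by definability.
- move=> t /exS[y Sy]; have [y0|y0] := lerP 0 y; first by left; exists y.
  by right; exists (- y); rewrite opprK; split=> //; lra.
- by have [f [df fS]] := has_choice_nonneg uv dS h; exists f; split=> //; apply: has_itv_widen fS.
- have [|f [df fS]] := @has_choice_nonneg (fun t y => S t (- y)) u v uv _ h; first by definability.
  exists (fun t => - f t); split; first by definability.
  exact: has_itv_widen fS.
Qed.

Lemma has_choice_row n : has_choice 'rV[R]_n.
Proof.
elim: n => [|n IH].
  move=> S a b ab dS exS; exists (fun=> 0); split; first by definability.
  by exists a, b; split=> // t /exS[y]; rewrite (_ : y = 0) //; apply/rowP => -[].
pose e (p : R * 'rV[R]_n) : 'rV[R]_n.+1 := row_mx (const_mx p.1 : 'rV_1) p.2.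
pose e' (w : 'rV[R]_(1 + n)) : R * 'rV[R]_n := (lsubmx w 0 0, rsubmx w).
apply: (has_choice_image (e := e) (e' := e')).
- by apply: dproj_dfun; exists id.
- move=> w; rewrite /e /= (_ : const_mx _ = lsubmx (w : 'rV_(1 + n))) ?hsubmxK //.
  by apply/rowP => j; rewrite mxE ord1.
- exact: has_choice_prod has_choice_real IH.
Qed.

End Choice.
Arguments has_choice {R} M T {eT}.

(** * Differentials as matrices *)

Section Differentials.
Variable R : rcfType.

Lemma norm_coord n (v : 'rV[R]_n) k : `|v 0 k| <= `|v|.
Proof.
by rewrite [`|v|]mx_normrE (le_bigmax_cond 0 (fun ij => `|v ij.1 ij.2|) (j := (0, k))).
Qed.

Lemma norm_row_le n (v : 'rV[R]_n) c :
  0 <= c -> (forall k, `|v 0 k| <= c) -> `|v| <= c.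
Proof.
move=> c0 h; rewrite [`|v|]mx_normrE; apply/bigmax_leP; split=> // -[i k] _ /=.
by rewrite ord1.
Qed.

Lemma norm_row_mx m n (a : 'rV[R]_m) (b : 'rV[R]_n) : `|row_mx a b| <= `|a| + `|b|.
Proof.
apply: norm_row_le => [|k]; first by rewrite addr_ge0.
rewrite mxE; case: split => j; apply: le_trans (norm_coord _ j) _;
  by rewrite ?lerDl ?lerDr.
Qed.

Lemma norm_row_mx_ltP m n (a a' : 'rV[R]_m) (b b' : 'rV[R]_n) d :
  `|row_mx a b - row_mx a' b'| < d <-> `|a - a'| < d /\ `|b - b'| < d.
Proof.
have -> : row_mx a b - row_mx a' b' = row_mx (a - a') (b - b').
  by rewrite opp_row_mx add_row_mx.
split=> [h|[h1 h2]].
  split; apply: le_lt_trans h; apply: norm_row_le => // k.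
    by rewrite -(row_mxEl (a - a') (b - b')) norm_coord.
  by rewrite -(row_mxEr (a - a') (b - b')) norm_coord.
have d0 : 0 < d by apply: le_lt_trans h1.
rewrite [`|_|]mx_normrE; apply/bigmax_ltP; split=> // -[i k] _ /=.
rewrite ord1 mxE; case: split => j.
  by apply: le_lt_trans h1; apply: norm_coord.
by apply: le_lt_trans h2; apply: norm_coord.
Qed.

Lemma norm_mulmx m n (L : 'M[R]_(m, n)) :
  exists2 C, 0 < C & forall v : 'rV_m, `|v *m L| <= C * `|v|.
Proof.
have s0 : 0 <= \sum_j \sum_k `|L j k| by apply: sumr_ge0 => j _; apply: sumr_ge0.
exists (\sum_j \sum_k `|L j k| + 1) => [|v]; first lra.
apply: norm_row_le => [|k]; first by rewrite mulr_ge0 //; lra.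
rewrite mxE; apply: le_trans (ler_norm_sum _ _ _) _.
apply: (@le_trans _ _ ((\sum_j \sum_k `|L j k|) * `|v|)); last first.
  by rewrite ler_wpM2r //; lra.
rewrite mulr_suml; apply: ler_sum => j _; rewrite normrM mulrC.
apply: ler_pM => //; last exact: norm_coord.
by rewrite (bigD1 k) //= lerDl sumr_ge0.
Qed.

(** Asserts existence of the derivative, whereas ['d f x] has a value for every [f]. Matrices act on
    row vectors from the right. *)
Definition hasdiff m n (f : 'rV[R]_m -> 'rV[R]_n) x (L : 'M[R]_(m, n)) : Prop :=
  forall e, 0 < e -> exists2 d, 0 < d &
    forall y, `|y - x| < d -> `|f y - f x - (y - x) *m L| <= e * `|y - x|.

Lemma open_norm n (U : set 'rV[R]_n) x :
  open U -> U x -> exists2 d, 0 < d & forall y, `|y - x| < d -> U y.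
Proof.
move=> oU Ux; have /(nbhs_normP x U)[d /= d0 h] := open_nbhs_nbhs (conj oU Ux).
by exists d => // y yx; apply: h; rewrite /ball_ /= distrC.
Qed.

Lemma norm_open n (U : set 'rV[R]_n) :
  (forall x, U x -> exists2 d, 0 < d & forall y, `|y - x| < d -> U y) -> open U.
Proof.
move=> h; rewrite openE => x Ux; apply/(nbhs_normP x U).
have [d d0 hd] := h x Ux; exists d => //= y; rewrite /ball_ /= distrC; exact: hd.
Qed.

Lemma differentiable_eps (V W : normedModType R) (f : V -> W) x :
  differentiable f x -> forall e, 0 < e -> exists2 d, 0 < d &
    forall y, `|y - x| < d -> `|f y - f x - 'd f x (y - x)| <= e * `|y - x|.
Proof.
move=> /diff_locallyP[_ /eqaddoP h] e e0.
have /nbhs_normP[d /= d0 hd] := h e e0; exists d => // y yx.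
have := hd (y - x); rewrite /ball_ /= sub0r normrN => /(_ yx).
by rewrite /= !functions.fctE /= subrK opprD addrA.
Qed.

Lemma differentiable_hasdiff m n (f : 'rV[R]_m -> 'rV[R]_n) x :
  differentiable f x -> hasdiff f x (lin1_mx ('d f x)).
Proof.
move=> df e e0; have [d d0 h] := differentiable_eps df e0.
by exists d => // y yx; rewrite mul_rV_lin1 h.
Qed.

Lemma hasdiff_lip m n (f : 'rV[R]_m -> 'rV[R]_n) x L : hasdiff f x L ->
  exists C d, [/\ 0 < C, 0 < d & forall y, `|y - x| < d -> `|f y - f x| <= C * `|y - x|].
Proof.
move=> df; have [d d0 h] := df 1 ltr01; have [C C0 hC] := norm_mulmx L.
exists (1 + C), d; split=> // [|y yx]; first lra.
rewrite -(subrK ((y - x) *m L) (f y - f x)) mulrDl.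
by apply: le_trans (ler_normD _ _) (lerD (h y yx) (hC _)).
Qed.

Lemma hasdiff_cont m n (f : 'rV[R]_m -> 'rV[R]_n) x L : hasdiff f x L ->
  forall e, 0 < e -> exists2 d, 0 < d & forall y, `|y - x| < d -> `|f y - f x| < e.
Proof.
move=> /hasdiff_lip[C [d [C0 d0 h]]] e e0.
exists (Num.min d (e / C)) => [|y]; first by rewrite lt_min d0 divr_gt0.
rewrite lt_min => /andP[yd]; rewrite ltr_pdivlMr // mulrC.
exact: le_lt_trans (h y yd).
Qed.

Lemma hasdiff_uniq m n (f : 'rV[R]_m -> 'rV[R]_n) x L K :
  hasdiff f x L -> hasdiff f x K -> L = K.
Proof.
move=> dL dK; apply/row_matrixP => i; rewrite !rowE; set v := delta_mx 0 i.
apply/eqP; rewrite -subr_eq0 -normr_eq0; apply/negPn/negP => n0.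
have {}n0 : 0 < `|v *m L - v *m K| by rewrite lt_neqAle eq_sym n0 normr_ge0.
have [C C0 vC] : exists2 C, 0 < C & `|v| <= C by exists (`|v| + 1) => //; rewrite ?ltr_wpDl ?lerDl.
(* Since [C] bounds the norm of [v], the two errors at [x + s *: v] add up to at most
   [2 * e * s * C], which is half of [s] times the norm of [v *m L - v *m K]. *)
set e := `|v *m L - v *m K| / (4 * C).
have e0 : 0 < e by rewrite divr_gt0 //; lra.
have [d1 d10 h1] := dL e e0; have [d2 d20 h2] := dK e e0.
set s := Num.min d1 d2 / (2 * C).
have s0 : 0 < s by rewrite divr_gt0 ?lt_min ?d10 //; lra.
have sv : `|x + s *: v - x| <= s * C.
  by rewrite addrAC subrr add0r normrZ gtr0_norm // ler_pM2l.
have sC : s * C = Num.min d1 d2 / 2 by rewrite /s; field; lra.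
have [l1 l2] : `|x + s *: v - x| < d1 /\ `|x + s *: v - x| < d2.
  by move: sv s0; rewrite sC /s /Order.min; case: ifP; lra.
have := lerD (h1 _ l1) (h2 _ l2); rewrite leNgt => /negP; apply.
have -> : x + s *: v - x = s *: v by rewrite addrAC subrr add0r.
rewrite -[X in _ < X + _]normrN.
apply: lt_le_trans (ler_normD _ _).
rewrite opprB addrC addrA subrK -!scalemxAl -scalerBr normrZ gtr0_norm // normrZ gtr0_norm //.
rewrite distrC [ltLHS](_ : _ = s * `|v| * (2 * e)); last by ring.
apply: (@le_lt_trans _ _ (s * C * (2 * e))).
  rewrite ler_pM2r; last lra.
  by rewrite ler_pM2l.
rewrite -mulrA ltr_pM2l //.
have -> : C * (2 * e) = `|v *m L - v *m K| / 2 by rewrite /e; field; lra.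
by rewrite (distrC (v *m K)); lra.
Qed.

Lemma hasdiff_near m n (f g : 'rV[R]_m -> 'rV[R]_n) x L d : 0 < d ->
  (forall y, `|y - x| < d -> f y = g y) -> hasdiff f x L -> hasdiff g x L.
Proof.
move=> d0 fg df e e0; have [d' d'0 h] := df e e0.
exists (Num.min d d') => [|y]; first by rewrite lt_min d0.
rewrite lt_min => /andP[y1 y2]; rewrite -!fg ?h // subrr normr0 //.
Qed.

Lemma hasdiff_cst m n (c : 'rV[R]_n) x : hasdiff (fun _ : 'rV[R]_m => c) x 0.
Proof.
by move=> e e0; exists 1 => // y _; rewrite mulmx0 !subr0 subrr normr0 mulr_ge0 // ltW.
Qed.

Lemma hasdiff_lin m n (L : 'M[R]_(m, n)) x : hasdiff (fun y => y *m L) x L.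
Proof.
move=> e e0; exists 1 => // y _.
by rewrite mulmxBl subrr normr0 mulr_ge0 // ltW.
Qed.

Lemma hasdiff_id m (x : 'rV[R]_m) : hasdiff (fun y => y) x 1%:M.
Proof.
by move=> e e0; exists 1 => // y _; rewrite mulmx1 subrr normr0 mulr_ge0 // ltW.
Qed.

Lemma hasdiff_comp m n p (f : 'rV[R]_m -> 'rV[R]_n) (g : 'rV[R]_n -> 'rV[R]_p) x L K :
  hasdiff f x L -> hasdiff g (f x) K -> hasdiff (fun y => g (f y)) x (L *m K).
Proof.
move=> df dg e e0.
have [C [d1 [C0 d10 h1]]] := hasdiff_lip df; have [B B0 hB] := norm_mulmx K.
have [|d2 d20 h2] := dg (e / (2 * C)); first by rewrite divr_gt0 //; lra.
have [|d3 d30 h3] := df (e / (2 * B)); first by rewrite divr_gt0 //; lra.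
have [d4 d40 h4] := hasdiff_cont df d20.
exists (Num.min d1 (Num.min d3 d4)) => [|y]; first by rewrite !lt_min d10 d30.
rewrite !lt_min => /and3P[y1 y3 y4].
have E : g (f y) - g (f x) - (y - x) *m (L *m K) =
    (g (f y) - g (f x) - (f y - f x) *m K) + (f y - f x - (y - x) *m L) *m K.
  by rewrite [(f y - f x - _) *m K]mulmxBl mulmxA addrA subrK.
rewrite E; apply: le_trans (ler_normD _ _) _.
rewrite [leRHS](_ : _ = e / (2 * C) * (C * `|y - x|) + B * (e / (2 * B) * `|y - x|)); last first.
  by field; lra.
apply: lerD; last by apply: le_trans (hB _) _; rewrite ler_pM2l // h3.
apply: le_trans (h2 _ (h4 _ y4)) _; rewrite ler_pM2l ?h1 //.
by rewrite divr_gt0 //; lra.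
Qed.

Lemma hasdiff_add m n (f g : 'rV[R]_m -> 'rV[R]_n) x L K :
  hasdiff f x L -> hasdiff g x K -> hasdiff (fun y => f y + g y) x (L + K).
Proof.
move=> df dg e e0; have e2 : 0 < e / 2 by lra.
have [d1 d10 h1] := df _ e2; have [d2 d20 h2] := dg _ e2.
exists (Num.min d1 d2) => [|y]; first by rewrite lt_min d10.
rewrite lt_min => /andP[y1 y2].
rewrite (_ : _ - _ = (f y - f x - (y - x) *m L) + (g y - g x - (y - x) *m K)).
  apply: le_trans (ler_normD _ _) (le_trans (lerD (h1 _ y1) (h2 _ y2)) _).
  by rewrite -mulrDl; rewrite (_ : e / 2 + e / 2 = e) //; field.
by rewrite mulmxDr addrACA -!opprD [in RHS]addrACA -opprD.
Qed.

Lemma hasdiff_row_mx m n p (f : 'rV[R]_m -> 'rV[R]_n) (g : 'rV[R]_m -> 'rV[R]_p) x L K :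
  hasdiff f x L -> hasdiff g x K ->
  hasdiff (fun y => row_mx (f y) (g y)) x (row_mx L K).
Proof.
move=> df dg e e0; have e2 : 0 < e / 2 by lra.
have [d1 d10 h1] := df _ e2; have [d2 d20 h2] := dg _ e2.
exists (Num.min d1 d2) => [|y]; first by rewrite lt_min d10.
rewrite lt_min => /andP[y1 y2].
rewrite mul_mx_row opp_row_mx add_row_mx opp_row_mx add_row_mx.
apply: le_trans (norm_row_mx _ _) (le_trans (lerD (h1 _ y1) (h2 _ y2)) _).
by rewrite -mulrDl; rewrite (_ : e / 2 + e / 2 = e) //; field.
Qed.

(** The scalar factor is presented as the entry of a row of length 1, the form in which [hasdiff]
    applies to it. Only the existence of the derivative is recorded. *)
Lemma hasdiff_scale m n (f : 'rV[R]_m -> R) (a : 'rV[R]_m -> 'rV[R]_1)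
    (g : 'rV[R]_m -> 'rV[R]_n) x L K :
  (forall y, f y = a y 0 0) -> hasdiff a x L -> hasdiff g x K ->
  exists N, hasdiff (fun y => f y *: g y) x N.
Proof.
move=> fa da dg; exists (L *m g x + f x *: K) => e e0.
have [C [d1 [C0 d10 h1]]] := hasdiff_lip da.
have G0 : 0 < `|g x| + 1 by have := normr_ge0 (g x); lra.
have F0 : 0 < `|f x| + 1 by have := normr_ge0 (f x); lra.
have [|d2 d20 h2] := hasdiff_cont dg (e := e / (3 * C)); first by rewrite divr_gt0 //; lra.
have [|d3 d30 h3] := da (e / (3 * (`|g x| + 1))); first by rewrite divr_gt0 //; lra.
have [|d4 d40 h4] := dg (e / (3 * (`|f x| + 1))); first by rewrite divr_gt0 //; lra.
exists (Num.min (Num.min d1 d2) (Num.min d3 d4)) => [|y].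
  by rewrite !lt_min d10 d20 d30.
rewrite !lt_min => /andP[/andP[y1 y2] /andP[y3 y4]].
set E1 := (f y - f x) *: (g y - g x).
set E2 := (a y - a x - (y - x) *m L) *m g x.
set E3 := f x *: (g y - g x - (y - x) *m K).
have E2E : E2 = (f y - f x) *: g x - (y - x) *m (L *m g x).
  rewrite /E2 mulmxBl mulmxA; congr (_ - _).
  by apply/rowP => k; rewrite !mxE big_ord1 !mxE !fa.
have E : f y *: g y - f x *: g x - (y - x) *m (L *m g x + f x *: K) = E1 + (E2 + E3).
  rewrite E2E /E1 /E3 mulmxDr -scalemxAr.
  move: ((y - x) *m (L *m g x)) ((y - x) *m K) => u v.
  by apply/rowP => k; rewrite !mxE; ring.
have n1 : `|E1| <= e / 3 * `|y - x|.
  rewrite normrZ (_ : e / 3 * _ = C * `|y - x| * (e / (3 * C))); last by field; lra.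
  apply: ler_pM => //; last exact/ltW/h2.
  rewrite !fa (_ : _ - _ = (a y - a x) 0 0); last by rewrite !mxE.
  exact: le_trans (norm_coord _ _) (h1 _ y1).
have n2 : `|E2| <= e / 3 * `|y - x|.
  rewrite /E2 (_ : _ *m _ = (a y - a x - (y - x) *m L) 0 0 *: g x); last first.
    by apply/rowP => k; rewrite !mxE big_ord1 !mxE.
  rewrite normrZ (_ : e / 3 * _ =
    e / (3 * (`|g x| + 1)) * `|y - x| * (`|g x| + 1)); last by field; lra.
  apply: ler_pM => //; last lra.
  exact: le_trans (norm_coord _ _) (h3 _ y3).
have n3 : `|E3| <= e / 3 * `|y - x|.
  rewrite /E3 normrZ (_ : e / 3 * _ =
    (`|f x| + 1) * (e / (3 * (`|f x| + 1)) * `|y - x|)); last by field; lra.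
  by apply: ler_pM => //; [lra|apply: h4].
rewrite E; apply: le_trans (ler_normD _ _) _.
have := ler_normD E2 E3; have : e * `|y - x| = e / 3 * `|y - x| + (e / 3 * `|y - x| + e / 3 * `|y - x|) by field.
lra.
Qed.

Lemma hasdiff_sum m n (I : finType) (f : I -> 'rV[R]_m -> 'rV[R]_n) x :
  (forall k, exists L, hasdiff (f k) x L) ->
  exists L, hasdiff (fun y => \sum_k f k y) x L.
Proof.
move=> df; elim: (index_enum I) => [|k s [L dL]].
  exists 0; apply: (@hasdiff_near _ _ (fun=> 0) _ _ _ 1) => // [y _|].
    by rewrite big_nil.
  exact: hasdiff_cst.
have [K dK] := df k; exists (K + L).
apply: (hasdiff_near (d := 1) _ _ (hasdiff_add dK dL)) => // y _.
by rewrite big_cons.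
Qed.

(** Returns from matrices to ['d], in terms of which [Ad] and [bracket] are defined; uniqueness of
    the differential also asks for continuity of the linear map. *)
Lemma hasdiff_diff m n (f : 'rV[R]_m -> 'rV[R]_n) x L v :
  hasdiff f x L -> 'd f x v = v *m L.
Proof.
move=> df.
have mc : continuous (mulmxr L : 'rV[R]_m -> 'rV[R]_n).
  move=> y; apply/(@cvgrPdist_lt R 'rV[R]_n 'rV[R]_m (nbhs y) (nbhs_filter y)) => e e0.
  have [d d0 h] := hasdiff_cont (hasdiff_lin L y) e0.
  apply/(nbhs_normP y [set t | `|y *m L - t *m L| < e]); exists d => //= z; rewrite /ball_ /= distrC => /h.
  by rewrite distrC.
rewrite (@diff_unique _ _ _ f (mulmxr L) x) //; apply/eqaddoP => e e0.
have [d d0 h] := df e e0. 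
refine (proj2 (@nbhs_normP R 'rV[R]_m 0 (fun t =>
    `|f (t + x) - (f x + t *m L)| <= e * `|t|)) _).
 exists d => //= y.
rewrite /ball_ /= sub0r normrN => yd; have := h (y + x).
by rewrite addrK opprD addrA; apply.
Qed.

End Differentials.

(** * Differential calculus on the group *)

Section Group.
Variables (R : rcfType) (M : ominimal R) (N : nat) (G : defGroup M N).
Variables (p d : nat) (X : defAtlas G p d).
Hypothesis p2 : (2 <= p)%N.
Implicit Types (g h x : 'rV[R]_N) (u v xi eta zeta : 'rV[R]_d) (w : 'rV[R]_(d + d)) (j k l : idx X).

Local Notation mul := (gmul G).
Local Notation inv := (ginv G).
Local Notation one := (gone G).

Lemma Ck_S (V W : normedModType R) n (U : set V) (f : V -> W) : (0 < n)%N ->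
  Ck n U f -> forall z : V, U z -> differentiable f z.
Proof. by case: n => // n _ [h _]. Qed.

Lemma Ck_D (V W : normedModType R) n (U : set V) (f : V -> W) (v : V) : (1 < n)%N ->
  Ck n U f -> forall z : V, U z -> differentiable (fun z => 'D_v f z : W) z.
Proof. by case: n => [|[|n]] // _ [_ /(_ v) h]; exact: (@Ck_S V W n.+1 U _ isT h). Qed.

Lemma p_gt0 : (0 < p)%N. Proof. exact: ltnW. Qed.

Lemma dom_carrier j x : dom j x -> carrier G x.
Proof. by move=> jx; apply/(dom_cover X); exists j. Qed.

Lemma carrier_dom x : carrier G x -> exists j, dom j x.
Proof. by move/(dom_cover X). Qed.

Lemma gmulKV x (y : 'rV[R]_N) : carrier G x -> carrier G y -> mul (mul x (inv y)) y = x.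
Proof.
move=> Gx Gy; rewrite -gmulA //; last exact: inv_closed.
by rewrite (proj1 (gmulV Gy)) (proj2 (gmul1 Gx)).
Qed.

Lemma gmulVK x (y : 'rV[R]_N) : carrier G x -> carrier G y -> mul (mul x y) (inv y) = x.
Proof.
move=> Gx Gy; rewrite -gmulA //; last exact: inv_closed.
by rewrite (proj2 (gmulV Gy)) (proj2 (gmul1 Gx)).
Qed.

Lemma gmulVKl x (y : 'rV[R]_N) : carrier G x -> carrier G y -> mul (inv x) (mul x y) = y.
Proof.
move=> Gx Gy; rewrite gmulA //; last exact: inv_closed.
by rewrite (proj1 (gmulV Gx)) (proj1 (gmul1 Gy)).
Qed.

Lemma ginv_uniq x (y : 'rV[R]_N) : carrier G x -> carrier G y -> mul x y = one -> y = inv x.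
Proof.
move=> Gx Gy xy; rewrite -(gmulVKl Gx Gy) xy.
by rewrite (proj2 (gmul1 (inv_closed Gx))).
Qed.

Lemma ginvM x (y : 'rV[R]_N) : carrier G x -> carrier G y -> inv (mul x y) = mul (inv y) (inv x).
Proof.
move=> Gx Gy; have [Vx Vy] := (inv_closed Gx, inv_closed Gy).
apply/esym/ginv_uniq; [exact: mul_closed|exact: mul_closed|].
by rewrite gmulA //; [rewrite gmulVK ?(proj2 (gmulV Gx))|exact: mul_closed].
Qed.

Lemma ginv1 : inv one = one.
Proof.
apply/esym/ginv_uniq; do ?exact: one_closed.
exact: (proj1 (gmul1 (one_closed G))).
Qed.

Definition near_dom m (F : 'rV[R]_m -> 'rV[R]_N) z j : Prop :=
  exists2 e, 0 < e & forall y, `|y - z| < e -> dom j (F y).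

(** A whole neighbourhood must be mapped into [dom j]: elsewhere [chart j] has arbitrary values, and
    a derivative would say nothing about the group. *)
Definition gdiff m j (F : 'rV[R]_m -> 'rV[R]_N) z (L : 'M[R]_(m, d)) : Prop :=
  near_dom F z j /\ hasdiff (fun y => chart j (F y)) z L.

Lemma near_dom_at m (F : 'rV[R]_m -> 'rV[R]_N) z j : near_dom F z j -> dom j (F z).
Proof. by case=> e e0; apply; rewrite subrr normr0. Qed.

Lemma gdiff_cst m (z : 'rV[R]_m) g j : dom j g -> gdiff j (fun=> g) z 0.
Proof. by split; [exists 1|exact: hasdiff_cst]. Qed.

Definition chart_image j : set 'rV[R]_d := [set chart j x | x in dom j].

Lemma chart_image_open j v : chart_image j v ->
  exists2 e, 0 < e & forall u, `|u - v| < e -> chart_image j u.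
Proof.
apply: open_norm; rewrite (_ : chart_image j = [set chart j x | x in dom j `&` dom j]).
  exact: transition_open.
by rewrite setIid.
Qed.

Lemma chart_invK j v : chart_image j v -> dom j (chart_inv j v) /\ chart j (chart_inv j v) = v.
Proof. by case=> x jx <-; rewrite chartK. Qed.

Lemma chart_imageP j x : dom j x -> chart_image j (chart j x).
Proof. by exists x. Qed.

Lemma gdiff_chart_inv j v : chart_image j v -> gdiff j (chart_inv j) v 1%:M.
Proof.
move=> /chart_image_open[e e0 h]; split; first by exists e => // y /h/chart_invK[].
by apply: hasdiff_near e0 _ (hasdiff_id v) => y /h/chart_invK[].
Qed.

Definition mulW j k l : set 'rV[R]_(d + d) := [set w |
  [/\ chart_image j (lsubmx w), chart_image k (rsubmx w) &
      dom l (mul (chart_inv j (lsubmx w)) (chart_inv k (rsubmx w)))]].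

Definition cmul j k l (w : 'rV[R]_(d + d)) : 'rV[R]_d :=
  chart l (mul (chart_inv j (lsubmx w)) (chart_inv k (rsubmx w))).

Definition jac j k l (w : 'rV[R]_(d + d)) : 'M[R]_(d + d, d) :=
  lin1_mx ('d (cmul j k l) w).

Lemma cmul_hasdiff j k l w : mulW j k l w -> hasdiff (cmul j k l) w (jac j k l w).
Proof.
move=> Ww; apply: differentiable_hasdiff.
exact: (Ck_S p_gt0 (mul_Ck j k l) Ww).
Qed.

Lemma mulW_open j k l w : mulW j k l w ->
  exists2 e, 0 < e & forall y, `|y - w| < e -> mulW j k l y.
Proof. by apply: open_norm; apply: mul_open. Qed.

Lemma mulW_row j k l x (y : 'rV[R]_N) : dom j x -> dom k y -> dom l (mul x y) ->
  mulW j k l (row_mx (chart j x) (chart k y)).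
Proof.
move=> jx ky lxy; split; rewrite ?row_mxKl ?row_mxKr ?chartK //; exact: chart_imageP.
Qed.

Lemma cmulE j k l x (y : 'rV[R]_N) : dom j x -> dom k y ->
  cmul j k l (row_mx (chart j x) (chart k y)) = chart l (mul x y).
Proof. by move=> jx ky; rewrite /cmul row_mxKl row_mxKr !chartK. Qed.

Lemma gdiff_mul m (F H : 'rV[R]_m -> 'rV[R]_N) z j k l L K :
  gdiff j F z L -> gdiff k H z K -> dom l (mul (F z) (H z)) ->
  gdiff l (fun y => mul (F y) (H y)) z
    (row_mx L K *m jac j k l (row_mx (chart j (F z)) (chart k (H z)))).
Proof.
move=> [nF dF] [nH dH] lz; have [jF kH] := (near_dom_at nF, near_dom_at nH).
have Ww := mulW_row jF kH lz.
have dFH := hasdiff_row_mx dF dH.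
have [e e0 he] := mulW_open Ww; have [e1 e10 h1] := hasdiff_cont dFH e0.
have [[e2 e20 h2] [e3 e30 h3]] := (nF, nH).
have e0' : 0 < Num.min e1 (Num.min e2 e3) by rewrite !lt_min e10 e20.
split.
  exists (Num.min e1 (Num.min e2 e3)) => // y.
  rewrite !lt_min => /and3P[/h1/he[_ _ +] /h2 jy /h3 ky].
  by rewrite row_mxKl row_mxKr !chartK.
apply: hasdiff_near e0' _ (hasdiff_comp dFH (cmul_hasdiff Ww)) => y.
by rewrite !lt_min => /and3P[_ /h2 jy /h3 ky]; rewrite cmulE.
Qed.

Lemma gdiff_inv m (F : 'rV[R]_m -> 'rV[R]_N) z j l L :
  gdiff j F z L -> dom l (inv (F z)) -> exists K, gdiff l (fun y => inv (F y)) z K.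
Proof.
move=> [nF dF] lz; have jF := near_dom_at nF.
have Vz : [set chart j x | x in dom j `&` [set x | dom l (inv x)]] (chart j (F z)).
  by exists (F z).
have [e e0 he] := open_norm (@inv_open _ _ _ _ _ _ X j l) Vz.
have [e1 e10 h1] := hasdiff_cont dF e0; have [e2 e20 h2] := nF.
have dI := differentiable_hasdiff (Ck_S p_gt0 (inv_Ck j l) Vz).
have e0' : 0 < Num.min e1 e2 by rewrite lt_min e10.
exists (L *m lin1_mx ('d (fun u => chart l (inv (chart_inv j u))) (chart j (F z)))).
split.
  exists (Num.min e1 e2) => // y; rewrite lt_min => /andP[/h1/he[x [jx lx] E] /h2 jy].
  by rewrite -(chartK jy) -E chartK.
apply: hasdiff_near e0' _ (hasdiff_comp dF dI) => y.
by rewrite lt_min => /andP[_ /h2 jy]; rewrite chartK.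
Qed.

(** * The adjoint representation and its derivative in a chart around the identity *)

Section Identity.
Variable i : idx X.
Hypothesis i1 : dom i one.

Local Notation o := (chart i one).

Lemma chart_inv_o : chart_inv i o = one. Proof. exact: chartK. Qed.

Lemma chart_image_o : chart_image i o. Proof. exact: chart_imageP. Qed.

Definition conj_chart g u : 'rV[R]_d := chart i (mul (mul g (chart_inv i u)) (inv g)).

Definition AdM g : 'M[R]_d := lin1_mx ('d (conj_chart g) o).

Lemma AdE g eta : Ad i g eta = eta *m AdM g.
Proof. by rewrite mul_rV_lin1. Qed.

Lemma conj_gdiff g : carrier G g ->
  exists L, gdiff i (fun u => mul (mul g (chart_inv i u)) (inv g)) o L.
Proof.
move=> Gg; have [j jg] := carrier_dom Gg; have [k kg] := carrier_dom (inv_closed Gg).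
have d1 := gdiff_mul (gdiff_cst o jg) (gdiff_chart_inv chart_image_o) (l := j).
rewrite /= chart_inv_o (proj2 (gmul1 Gg)) in d1.
have d2 := gdiff_mul (d1 jg) (gdiff_cst o kg) (l := i).
rewrite /= chart_inv_o (proj2 (gmul1 Gg)) (proj2 (gmulV Gg)) in d2.
by exists (row_mx
   (row_mx 0 1%:M *m jac j i j (row_mx (chart j g) (chart i one))) 0 *m
   jac j k i (row_mx (chart j g) (chart k (inv g)))); apply: d2.
Qed.

Lemma conj_AdM g : carrier G g ->
  gdiff i (fun u => mul (mul g (chart_inv i u)) (inv g)) o (AdM g).
Proof.
move=> /conj_gdiff[L [nL dL]]; split=> //.
suff -> : AdM g = L by [].
by apply/row_matrixP => r; rewrite !rowE mul_rV_lin1 (hasdiff_diff _ dL).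
Qed.

Lemma conj_o g : carrier G g -> conj_chart g o = o.
Proof.
by move=> Gg; rewrite /conj_chart chart_inv_o (proj2 (gmul1 Gg)) (proj2 (gmulV Gg)).
Qed.

(** Chain rule at the fixed point [o] of both conjugations; the order is reversed because row
    vectors are multiplied on the right. *)
Lemma AdM_mul g h : carrier G g -> carrier G h -> AdM (mul g h) = AdM h *m AdM g.
Proof.
move=> Gg Gh; have [_ d1] := conj_AdM (mul_closed Gg Gh).
have [nh dh] := conj_AdM Gh; have [_ dg] := conj_AdM Gg.
apply: (hasdiff_uniq d1).
have [e e0 he] := nh; have [e1 e10 h1] := chart_image_open chart_image_o.
have e0' : 0 < Num.min e e1 by rewrite lt_min e0.
have dg' : hasdiff (conj_chart g) (conj_chart h o) (AdM g) by rewrite conj_o.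
apply: hasdiff_near e0' _ (hasdiff_comp dh dg') => u.
rewrite lt_min => /andP[/he iu /h1/chart_invK[iu' _]].
have Gu := dom_carrier iu'; rewrite /conj_chart /= chartK // ginvM //.
have [Vg Vh] := (inv_closed Gg, inv_closed Gh).
rewrite !gmulA //; do ?[exact: mul_closed | apply: mul_closed => //]; congr (chart i (mul _ _)).
Qed.

Lemma AdM1 : AdM one = 1%:M.
Proof.
have [_ d1] := conj_AdM (one_closed G).
apply: (hasdiff_uniq d1); have [e e0 he] := chart_image_open chart_image_o.
apply: hasdiff_near e0 _ (hasdiff_id o) => u /he/chart_invK[iu E].
have Gu := dom_carrier iu.
by rewrite ginv1 (proj1 (gmul1 Gu)) (proj2 (gmul1 Gu)) E.
Qed.

Local Notation m := (cmul i i i).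
Local Notation J := (jac i i i).
Local Notation W := (mulW i i i).

Lemma mulW_oo : W (row_mx o o).
Proof. by apply: mulW_row; rewrite // (proj1 (gmul1 (one_closed G))). Qed.

(** The product restricts to the identity map on each of the two axes through [(o, o)]. *)
Lemma jac_oo u v : row_mx u v *m J (row_mx o o) = u + v.
Proof.
have dJ := cmul_hasdiff mulW_oo.
have [e e0 he] := chart_image_open chart_image_o.
have l1 : row_mx 1%:M 0 *m J (row_mx o o) = 1%:M.
  apply: hasdiff_uniq (hasdiff_comp (hasdiff_row_mx (hasdiff_id o) (hasdiff_cst o o)) dJ) _.
  apply: hasdiff_near e0 _ (hasdiff_id o) => z /he/chart_invK[iu E].
  by rewrite -[in RHS]E cmulE // (proj2 (gmul1 (dom_carrier iu))).
have l2 : row_mx 0 1%:M *m J (row_mx o o) = 1%:M.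
  apply: hasdiff_uniq (hasdiff_comp (hasdiff_row_mx (hasdiff_cst o o) (hasdiff_id o)) dJ) _.
  apply: hasdiff_near e0 _ (hasdiff_id o) => z /he/chart_invK[iu E].
  by rewrite -[in RHS]E cmulE // (proj1 (gmul1 (dom_carrier iu))).
have -> : row_mx u v = u *m row_mx 1%:M 0 + v *m row_mx 0 1%:M.
  by rewrite !mul_mx_row !mulmx1 !mulmx0 add_row_mx addr0 add0r.
by rewrite mulmxDl -!mulmxA l1 l2 !mulmx1.
Qed.

Definition cinv u : 'rV[R]_d := chart i (inv (chart_inv i u)).

Lemma cinv_gdiff : exists L, gdiff i (fun u => inv (chart_inv i u)) o L.
Proof.
apply: gdiff_inv (gdiff_chart_inv chart_image_o) _.
by rewrite chart_inv_o ginv1.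
Qed.

Lemma cinv_o : cinv o = o.
Proof. by rewrite /cinv chart_inv_o ginv1. Qed.

Lemma near_o : exists2 e, 0 < e & forall u, `|u - o| < e ->
  chart_image i u /\ dom i (inv (chart_inv i u)).
Proof.
have [e e0 he] := chart_image_open chart_image_o; have [L [[e1 e10 h1] _]] := cinv_gdiff.
exists (Num.min e e1) => [|u]; first by rewrite lt_min e0.
by rewrite lt_min => /andP[/he ? /h1].
Qed.

Lemma mulW_cinv u : chart_image i u -> dom i (inv (chart_inv i u)) -> W (row_mx u (cinv u)).
Proof.
move=> /chart_invK[iu E] iV; rewrite -{1}E; apply: mulW_row => //.
by rewrite (proj2 (gmulV (dom_carrier iu))).
Qed.

Definition Dm w' w : 'rV[R]_d := 'D_w' m w.

Lemma DmE w' w : W w -> Dm w' w = w' *m J w.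
Proof. by move=> Ww; rewrite mul_rV_lin1 -deriveE //; apply: Ck_S p_gt0 (mul_Ck _ _ _) _ Ww. Qed.

(** The step that consumes a second derivative of the product: [Ad] is built from first derivatives
    of it and has to be differentiated once more. *)
Lemma Dm_hasdiff w' w : W w -> exists L, hasdiff (Dm w') w L.
Proof.
move=> Ww; exists (lin1_mx ('d (Dm w') w)); apply: differentiable_hasdiff.
exact: (Ck_D w' p2 (mul_Ck i i i) Ww).
Qed.

(* The derivative of y |-> y (inv_i u)^-1 at u in the direction x, where
   w = (x, u). *)
Definition Theta w : 'rV[R]_d := \sum_k lsubmx w 0 k *:
  Dm (row_mx (delta_mx 0 k) 0) (row_mx (rsubmx w) (cinv (rsubmx w))).

Lemma hasdiff_rsubmx (w : 'rV[R]_(d + d)) :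
  hasdiff (fun w => rsubmx w) w (col_mx 0 1%:M : 'M_(d + d, d)).
Proof.
apply: hasdiff_near ltr01 _ (hasdiff_lin _ w) => y _.
by rewrite -{1}[y]hsubmxK mul_row_col mulmx0 mulmx1 add0r.
Qed.

(** Expanding along the basis makes [Theta] a sum of coordinates times derivatives of the product in
    fixed directions, and these depend on the base point alone. *)
Lemma Theta_hasdiff xi : exists L, hasdiff Theta (row_mx xi o) L.
Proof.
apply: hasdiff_sum => k.
have d1 := hasdiff_rsubmx (row_mx xi o).
have [L2 [_ d2]] := cinv_gdiff.
have d3 : hasdiff (fun u => row_mx u (cinv u)) (rsubmx (row_mx xi o)) (row_mx 1%:M L2).
  by rewrite row_mxKr; apply: hasdiff_row_mx => //; apply: hasdiff_id.
have [|L4 d4] := @Dm_hasdiff (row_mx (delta_mx 0 k) 0)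
    (row_mx (rsubmx (row_mx xi o)) (cinv (rsubmx (row_mx xi o)))).
  by rewrite row_mxKr cinv_o; apply: mulW_oo.
have d5 := hasdiff_comp d1 (hasdiff_comp d3 d4).
apply: hasdiff_scale (hasdiff_lin (col_mx (delta_mx k 0) 0) _) d5 => y.
by rewrite -{2}[y]hsubmxK mul_row_col mulmx0 addr0 -colE [in RHS]mxE.
Qed.

Lemma ThetaE xi u : W (row_mx u (cinv u)) ->
  Theta (row_mx xi u) = row_mx xi 0 *m J (row_mx u (cinv u)).
Proof.
move=> Ww; rewrite /Theta row_mxKl row_mxKr.
have -> : row_mx xi 0 = \sum_k xi 0 k *: row_mx (delta_mx 0 k) (0 : 'rV[R]_d).
  have E (y : 'rV[R]_d) : row_mx y 0 = y *m row_mx 1%:M (0 : 'M[R]_d).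
    by rewrite mul_mx_row mulmx1 mulmx0.
  rewrite E {1}[xi]row_sum_delta mulmx_suml; apply: eq_bigr => k _.
  by rewrite -scalemxAl -E.
rewrite mulmx_suml; apply: eq_bigr => k _.
by rewrite -scalemxAl DmE.
Qed.

Lemma Theta_o xi : Theta (row_mx xi o) = xi.
Proof.
by rewrite ThetaE cinv_o; [rewrite jac_oo addr0|exact: mulW_oo].
Qed.

(** Conjugation by [g] is left translation, with derivative [Dm (row_mx 0 zeta)] at [(u, o)],
    followed by right translation by the inverse of [g], with derivative [Theta] at [u]. *)
Lemma Ad_Theta u zeta : chart_image i u -> dom i (inv (chart_inv i u)) ->
  Ad i (chart_inv i u) zeta = Theta (row_mx (Dm (row_mx 0 zeta) (row_mx u o)) u).
Proof.
move=> iu iV; have [iu' E] := chart_invK iu; set g := chart_inv i u in iu' E iV *.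
have Gg := dom_carrier iu'.
have d1 := gdiff_mul (gdiff_cst o iu') (gdiff_chart_inv chart_image_o) (l := i).
rewrite /= chart_inv_o (proj2 (gmul1 Gg)) E in d1.
have d2 := gdiff_mul (d1 iu') (gdiff_cst o iV) (l := i).
rewrite /= chart_inv_o (proj2 (gmul1 Gg)) (proj2 (gmulV Gg)) E -/(cinv u) in d2.
have [_ dA] := conj_AdM Gg; have [_ {d1}d2] := d2 i1.
rewrite AdE (hasdiff_uniq dA d2) ThetaE; last exact: mulW_cinv.
rewrite mulmxA; congr (_ *m _); rewrite mul_mx_row mulmx0; congr (row_mx _ 0).
rewrite DmE; last by rewrite -E; apply: mulW_row => //; rewrite (proj2 (gmul1 Gg)).
by rewrite mulmxA mul_mx_row mulmx0 mulmx1.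
Qed.

Lemma Ad_hasdiff zeta : exists L, hasdiff (fun u => Ad i (chart_inv i u) zeta) o L.
Proof.
have [e e0 he] := near_o.
have [L1 d1] := @Dm_hasdiff (row_mx 0 zeta) (row_mx o o) mulW_oo.
have d2 := hasdiff_comp (hasdiff_row_mx (hasdiff_id o) (hasdiff_cst o o)) d1.
have [L3 d3] := Theta_hasdiff (Dm (row_mx 0 zeta) (row_mx o o)).
have d4 := hasdiff_comp (hasdiff_row_mx d2 (hasdiff_id o)) d3.
eexists; apply: hasdiff_near e0 _ d4 => u /he[iu iV].
by rewrite Ad_Theta.
Qed.

Lemma transl_gdiff j v g l : chart_image j v -> carrier G g ->
  dom l (mul (chart_inv j v) g) ->
  exists L, gdiff l (fun u => mul (chart_inv j u) g) v L.
Proof.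
move=> jv Gg lg; have [k kg] := carrier_dom Gg.
eexists; exact: gdiff_mul (gdiff_chart_inv jv) (gdiff_cst v kg) lg.
Qed.

Section Quotient.
Variable P : 'M[R]_d.
Hypothesis bracketP : forall xi eta, bracket i xi eta *m P = 0.

(** With [g] the point of coordinate [v], the action of a nearby [x] is that of [x g^-1] on the
    fixed vector [Ad i g eta]. Right translation by [g^-1] brings the base point to the identity,
    where the derivative is a bracket. *)
Lemma Ad_flat eta v : chart_image i v ->
  hasdiff (fun u => Ad i (chart_inv i u) eta *m P) v 0.
Proof.
move=> iv; have [iv' E] := chart_invK iv; have Gg := dom_carrier iv'.
set g := chart_inv i v in iv' Gg E.
have ge : mul (chart_inv i v) (inv g) = one by rewrite (proj2 (gmulV Gg)).
have [|L1 [[e e0 he] d1]] := transl_gdiff iv (inv_closed Gg) (l := i); first by rewrite ge.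
have [L2 d2] := Ad_hasdiff (Ad i g eta).
have LP : L2 *m P = 0.
  apply/row_matrixP => r; rewrite rowE row0 mulmxA.
  by rewrite -(hasdiff_diff _ d2); apply: bracketP.
have d2' : hasdiff (fun u => Ad i (chart_inv i u) (Ad i g eta))
    (chart i (mul (chart_inv i v) (inv g))) L2 by rewrite ge.
have := hasdiff_comp (hasdiff_comp d1 d2') (hasdiff_lin P _).
rewrite -mulmxA LP mulmx0; have [e1 e10 h1] := chart_image_open iv.
apply: (hasdiff_near (d := Num.min e e1)) => [|u]; first by rewrite lt_min e0.
rewrite lt_min => /andP[/he iu /h1/chart_invK[iu1 _]]; rewrite chartK //; congr (_ *m _).
by rewrite !AdE -mulmxA -(AdM_mul (dom_carrier iu) Gg) (gmulKV (dom_carrier iu1) Gg).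
Qed.

End Quotient.
End Identity.
End Group.

(** * The kernel of the adjoint action on the quotient *)

Section DefinableGroup.
Variables (R : rcfType) (M : ominimal R) (N : nat) (G : defGroup M N).
Variables (p d : nat) (X : defAtlas G p d).
Hypothesis p2 : (2 <= p)%N.
Variable i : idx X.
Hypothesis i1 : dom i (gone G).

Local Notation mul := (gmul G).
Local Notation inv := (ginv G).
Local Notation one := (gone G).
Local Notation o := (chart i one).

Lemma definable_map_total m n (A : set 'rV[R]_m) (f : 'rV[R]_m -> 'rV[R]_n) :
  definable M A -> definable_map M A f ->
  exists F, dfun M F /\ forall x, A x -> F x = f x.
Proof.
move=> dA df.
have [||||F [dF FP _]] := @dfun_description R M 'rV[R]_m _ 'rV[R]_n _ A
    (fun x y => A x /\ y = f x).
- exact: dA.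
- exact: df.
- by move=> x Ax; exists (f x).
- by move=> x y z _ [_ ->] [_ ->].
by exists F; split=> // x /FP[].
Qed.

Lemma total_mul : exists mu : 'rV[R]_N * 'rV[R]_N -> 'rV[R]_N,
  dfun M mu /\ forall x y, carrier G x -> carrier G y -> mu (x, y) = mul x y.
Proof.
have dGG := definableX (carrier_def G) (carrier_def G).
have [F [dF FE]] := definable_map_total dGG (mul_def G).
exists (fun q => F (row_mx q.1 q.2)); split=> [|x y Gx Gy /=].
  by apply: (dfun_comp dF); apply: dproj_dfun; exists id.
by rewrite FE /= ?row_mxKl ?row_mxKr.
Qed.

(** Only the product is given as definable; the inverse is recovered as the unique solution of an
    equation in it. *)
Lemma total_inv : exists iv, dfun M iv /\ forall x, carrier G x -> iv x = inv x.
Proof.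
have [mu [dmu muE]] := total_mul; have dG : dpred M (carrier G) by exact: carrier_def.
have [||||F [dF FP _]] := @dfun_description R M 'rV[R]_N _ 'rV[R]_N _ (carrier G)
    (fun x y => carrier G x /\ carrier G y /\ mu (x, y) = one).
- by [].
- by definability.
- move=> x Gx; have Vx := inv_closed Gx; exists (inv x).
  by rewrite muE // (proj2 (gmulV Gx)).
- move=> x y z Gx [_ [Gy]]; rewrite muE // => /ginv_uniq-> // [_ [Gz]].
  by rewrite muE // => /ginv_uniq->.
exists F; split=> // x Gx; have [_ [GF]] := FP x Gx.
by rewrite muE // => /ginv_uniq->.
Qed.

Lemma total_chart (j : idx X) :
  exists c, dfun M c /\ forall x, dom j x -> c x = chart j x.
Proof. exact: definable_map_total (dom_def j) (chart_def j). Qed.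

Lemma total_chart_inv (j : idx X) :
  exists c, dfun M c /\ forall v, chart_image j v -> c v = chart_inv j v.
Proof.
have [ch [dch chE]] := total_chart j; have dj : dpred M (dom j) by exact: dom_def.
have [||||F [dF FP _]] := @dfun_description R M 'rV[R]_d _ 'rV[R]_N _
    (fun v => exists x, dom j x /\ ch x = v) (fun v x => dom j x /\ ch x = v).
- by definability.
- by definability.
- by [].
- move=> v x y _ [jx <-] [jy]; rewrite !chE // => xy.
  by rewrite -(chartK jx) -xy chartK.
exists F; split=> // v [x jx <-]; have [|jF] := FP (chart j x).
  by exists x; rewrite chE.
by rewrite chE // => E; rewrite -[LHS](chartK jF) E.
Qed.

(** The differential is not itself a formula over [M]. Its value is singled out by [Q], the
    coordinatewise one-sided limit of difference quotients, which is first-order and has at most one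
    solution. *)
Lemma total_Ad : exists A : 'rV[R]_N * 'rV[R]_d -> 'rV[R]_d,
  dfun M A /\ forall g eta, carrier G g -> A (g, eta) = Ad i g eta.
Proof.
have [mu [dmu muE]] := total_mul; have [iv [div ivE]] := total_inv.
have [ch [dch chE]] := total_chart i; have [ci [dci ciE]] := total_chart_inv i.
have dG : dpred M (carrier G) by exact: carrier_def.
pose c g u := ch (mu (mu (g, ci u), iv g)).
have cE g : carrier G g -> exists2 e, 0 < e &
    forall u, `|u - o| < e -> c g u = conj_chart i g u.
  move=> Gg; have [[e e0 he] _] := conj_AdM p2 i1 Gg.
  have [e1 e10 h1] := chart_image_open (chart_image_o i1).
  exists (Num.min e e1) => [|u]; first by rewrite lt_min e0.
  rewrite lt_min => /andP[/he iu /h1 iu1]; have [iu2 _] := chart_invK iu1.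
  have Gu := dom_carrier iu2; rewrite /c ciE // ivE // (muE _ _ Gg Gu).
  by rewrite (muE _ _ (mul_closed Gg Gu) (inv_closed Gg)) chE.
pose Q (q : 'rV[R]_N * 'rV[R]_d) (y : 'rV[R]_d) :=
  forall k : 'I_d, forall e : R, 0 < e -> exists r : R, 0 < r /\
    forall t : R, 0 < t -> t < r ->
      - (e * t) <= c q.1 (o + t *: q.2) 0 k - o 0 k - t * y 0 k /\
      c q.1 (o + t *: q.2) 0 k - o 0 k - t * y 0 k <= e * t.
have QAd g eta : carrier G g -> Q (g, eta) (Ad i g eta).
  move=> Gg; rewrite AdE => k e e0.
  have [r r0 cr] := cE g Gg; have [_ dc] := conj_AdM p2 i1 Gg.
  (* The added 1 keeps the divisor positive when [eta] vanishes. *)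
  have n0 : 0 < `|eta| + 1 by rewrite ltr_wpDl.
  have [r1 r10 h1] := dc (e / (`|eta| + 1)) (divr_gt0 e0 n0).
  exists (Num.min r r1 / (`|eta| + 1)); split; first by rewrite divr_gt0 // lt_min r0.
  move=> t t0; rewrite ltr_pdivlMr // lt_min => /andP[tr tr1].
  have E : o + t *: eta - o = t *: eta by rewrite addrAC subrr add0r.
  have tn : `|o + t *: eta - o| <= t * (`|eta| + 1).
    by rewrite E normrZ gtr0_norm // ler_pM2l // lerDl.
  have := h1 _ (le_lt_trans tn tr1); rewrite -!/(conj_chart i g _) conj_o //.
  rewrite -cr ?(le_lt_trans tn) // E -scalemxAl => le1.
  have le2 : e / (`|eta| + 1) * `|t *: eta| <= e * t.
    rewrite normrZ gtr0_norm // mulrAC ler_pdivrMr // -mulrA ler_pM2l //.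
    by rewrite ler_pM2l // lerDl.
  have := le_trans (norm_coord _ k) (le_trans le1 le2).
  by rewrite !mxE ler_norml => /andP[].
have Quniq q y z : Q q y -> Q q z -> y = z.
  move=> hy hz; apply/rowP => k.
  apply/eqP; rewrite -subr_eq0 -normr_eq0; apply/negPn/negP => n0.
  have {}n0 : 0 < `|y 0 k - z 0 k| by rewrite lt_neqAle eq_sym n0 normr_ge0.
  have e0 : 0 < `|y 0 k - z 0 k| / 4 by lra.
  have [r [r0 hr]] := hy k _ e0; have [s [s0 hs]] := hz k _ e0.
  pose t := Num.min r s / 2.
  have [t0 tr ts] : [/\ 0 < t, t < r & t < s].
    by rewrite /t /Order.min; case: ifP; split; lra.
  have [a1 a2] := hr t t0 tr; have [b1 b2] := hs t t0 ts.
  have : `|t * (y 0 k - z 0 k)| <= 2 * (`|y 0 k - z 0 k| / 4 * t).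
    by rewrite ler_norml mulrBr; apply/andP; split; lra.
  rewrite normrM gtr0_norm //.
  have : 0 < t * `|y 0 k - z 0 k| by rewrite mulr_gt0.
  lra.
have [||||A [dA AP _]] := @dfun_description R M ('rV[R]_N * 'rV[R]_d)%type _ 'rV[R]_d _
    (fun q => carrier G q.1) Q.
- by definability.
- by rewrite /Q /c; definability.
- by move=> [g eta] Gg; exists (Ad i g eta); apply: QAd.
- by move=> q y z _; apply: Quniq.
exists A; split=> // g eta Gg; apply: (Quniq (g, eta)); last exact: QAd.
exact: AP (g, eta) Gg.
Qed.

End DefinableGroup.

(** * The elements acting trivially modulo the ideal form the whole group *)

Section AdjointKernel.
Variables (R : rcfType) (M : ominimal R) (N : nat) (G : defGroup M N).
Variables (p d : nat) (X : defAtlas G p d).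
Hypothesis p2 : (2 <= p)%N.
Variable i : idx X.
Hypothesis i1 : dom i (gone G).
Variable P : 'M[R]_d.
Hypothesis bracketP : forall xi eta, bracket i xi eta *m P = 0.

Local Notation mul := (gmul G).
Local Notation inv := (ginv G).
Local Notation one := (gone G).
Local Notation o := (chart i one).

Definition Ad_trivial : set 'rV[R]_N :=
  [set g | carrier G g /\ forall eta, Ad i g eta *m P = eta *m P].

Lemma definable_Ad_trivial : definable M Ad_trivial.
Proof.
have [A [dA AE]] := total_Ad p2 i1.
have dG : dpred M (carrier G) by exact: carrier_def.
have dK : dpred M (fun g => carrier G g /\ forall eta, A (g, eta) *m P = eta *m P).
  by definability.
apply: (eq_definable dK) => g.
by split=> -[Gg h]; split=> // eta; have := h eta; rewrite AE.
Qed.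

Lemma Ad_trivial_mul g h : Ad_trivial g -> Ad_trivial h -> Ad_trivial (mul g h).
Proof.
move=> [Gg hg] [Gh hh]; split=> [|eta]; first exact: mul_closed.
by rewrite AdE (AdM_mul p2 i1 Gg Gh) mulmxA -(AdE i h) -(AdE i g) hg hh.
Qed.

Lemma Ad_trivial1 : Ad_trivial one.
Proof. by split=> [|eta]; [exact: one_closed|rewrite AdE (AdM1 p2 i1) mulmx1]. Qed.

Lemma Ad_trivial_inv g : Ad_trivial g -> Ad_trivial (inv g).
Proof.
move=> [Gg hg]; split=> [|eta]; first exact: inv_closed.
have E : Ad i g (Ad i (inv g) eta) = eta.
  rewrite (AdE i g) (AdE i (inv g)) -mulmxA -(AdM_mul p2 i1 Gg (inv_closed Gg)).
  by rewrite (proj2 (gmulV Gg)) (AdM1 p2 i1) mulmx1.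
by rewrite -[LHS]hg E.
Qed.

(** Along the segment from [o] to [u], which stays in the chart, each coordinate of the action
    modulo [P] is definable with zero derivative, hence equal to its value at the identity. *)
Lemma Ad_trivial_near : exists2 r, 0 < r & forall u, `|u - o| < r ->
  chart_image i u /\ Ad_trivial (chart_inv i u).
Proof.
have [r r0 hr] := chart_image_open (chart_image_o i1).
exists r => // u ur; split; first exact: hr.
split=> [|eta]; first exact: dom_carrier (proj1 (chart_invK (hr u ur))).
have [A [dA AE]] := total_Ad p2 i1; have [ci [dci ciE]] := total_chart_inv i.
have inr s : 0 <= s -> s <= 1 -> chart_image i (o + s *: (u - o)).
  move=> s0 s1; apply: hr; rewrite addrAC subrr add0r normrZ ger0_norm //.
  by apply: le_lt_trans ur; rewrite ler_piMl.
pose f k s : R := (A (ci (o + s *: (u - o)), eta) *m P) 0 k.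
have fE k s : 0 <= s -> s <= 1 ->
    f k s = (Ad i (chart_inv i (o + s *: (u - o))) eta *m P) 0 k.
  move=> s0 s1; have iv := inr s s0 s1.
  by rewrite /f ciE // AE //; apply: dom_carrier (proj1 (chart_invK iv)).
have flat k s e : 0 <= s -> s <= 1 -> 0 < e -> exists2 r, 0 < r & forall t,
    0 <= t -> t <= 1 -> `|t - s| < r -> `|f k t - f k s| <= e * `|t - s|.
  move=> s0 s1 e0; have n0 : 0 < `|u - o| + 1 by rewrite ltr_wpDl.
  have [r1 r10 h1] := Ad_flat p2 i1 bracketP eta (inr s s0 s1) (divr_gt0 e0 n0).
  exists (r1 / (`|u - o| + 1)) => [|t t0 t1]; first by rewrite divr_gt0.
  have E : o + t *: (u - o) - (o + s *: (u - o)) = (t - s) *: (u - o).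
    by rewrite opprD addrACA subrr add0r -scalerBl.
  rewrite ltr_pdivlMr // => ts; rewrite !fE //.
  have /h1 : `|o + t *: (u - o) - (o + s *: (u - o))| < r1.
    by rewrite E normrZ; apply: le_lt_trans ts; rewrite ler_wpM2l // lerDl.
  rewrite mulmx0 subr0 E normrZ => le1.
  have subE (a b : 'rV[R]_d) : a 0 k - b 0 k = (a - b) 0 k by rewrite !mxE.
  rewrite subE; apply: le_trans (le_trans (norm_coord _ k) le1) _.
  rewrite mulrAC ler_pdivrMr // -mulrA ler_pM2l // ler_wpM2l //.
  by rewrite lerDl.
have fc k : f k 1 = f k 0.
  apply: (@flat_const R M).
  - by [].
  - by rewrite /f; definability.
  - move=> s e s0 s1 e0; have [r1 r10 h1] := flat k s e s0 (ltW s1) e0.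
    exists r1 => // t st ts t1; have tsn : `|t - s| = t - s by rewrite gtr0_norm ?subr_gt0.
    by rewrite -[X in _ * X]tsn; apply: h1; rewrite ?tsn; lra.
  - move=> s e s0 s1 e0; have [r1 r10 h1] := flat k s e (ltW s0) s1 e0.
    exists r1 => // t ts st t0.
    have tsn : `|t - s| = s - t by rewrite ltr0_norm ?subr_lt0 // opprB.
    have := h1 t t0 (le_trans (ltW st) s1); rewrite tsn => /(_ ltac:(lra)) /le_trans; apply.
    by rewrite ger_pMr //; lra.
have uE : o + (u - o) = u by rewrite addrC subrK.
have E : Ad i (chart_inv i u) eta *m P = Ad i (chart_inv i o) eta *m P.
  apply/rowP => k; have := fc k.
  by rewrite (fE k 1 ler01 (lexx 1)) (fE k 0 (lexx 0) ler01) scale1r scale0r addr0 uE.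
apply: (etrans E); rewrite (chart_inv_o i1).
by have [_] := Ad_trivial1; apply.
Qed.

(** Points near [g] have the form [k g] with [k] near the identity, hence with [k] in the kernel.
    This serves both for the kernel and for its complement. *)
Lemma translation_open (S : set 'rV[R]_N) : S `<=` carrier G ->
  (forall k g, Ad_trivial k -> S g -> S (mul k g)) -> manifold_open X S.
Proof.
move=> SG hS; split=> // j; apply: norm_open => _ [g [Sg jg] <-].
have Gg := SG _ Sg; have ij := chart_imageP jg; have E := chartK jg.
have ge : mul (chart_inv j (chart j g)) (inv g) = one by rewrite E (proj2 (gmulV Gg)).
have [|L [[e e0 he] dL]] := transl_gdiff p2 (l := i) ij (inv_closed Gg); first by rewrite ge.
have [r r0 hr] := Ad_trivial_near.
have [e1 e10 h1] := hasdiff_cont dL r0; have [e2 e20 h2] := chart_image_open ij.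
exists (Num.min e (Num.min e1 e2)) => [|u]; first by rewrite !lt_min e0 e10.
rewrite !lt_min => /and3P[/he iu /h1 + /h2 ju]; rewrite ge => /hr[_].
rewrite chartK // => Kk; have [ju' ju2] := chart_invK ju.
exists (chart_inv j u) => //; split=> //.
by rewrite -(gmulKV (dom_carrier ju') Gg); apply: hS.
Qed.

Lemma AdM_quotient : definably_connected X ->
  forall g, carrier G g -> AdM i g *m P = P.
Proof.
move=> conn; have [|||KG|KG] := conn _ definable_Ad_trivial.
- by move=> g [].
- apply: translation_open => [g []//|k g]; exact: Ad_trivial_mul.
- apply: translation_open => [g []//|k g Kk [Gg nK]]; have Gk := proj1 Kk.
  split=> [|Kkg]; first exact: mul_closed Gk Gg.
  apply: nK; rewrite -(gmulVKl Gk Gg).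
  exact: Ad_trivial_mul (Ad_trivial_inv Kk) Kkg.
- by have := Ad_trivial1; rewrite KG.
move=> g; rewrite -KG => -[_ hg]; apply/row_matrixP => r.
by rewrite !rowE mulmxA -AdE hg.
Qed.

End AdjointKernel.

(** * Curves in the group to first order, modulo the ideal *)

Section Curves.
Variables (R : rcfType) (M : ominimal R) (N : nat) (G : defGroup M N).
Variables (p d : nat) (X : defAtlas G p d).
Hypothesis p2 : (2 <= p)%N.
Variable i : idx X.
Hypothesis i1 : dom i (gone G).
Implicit Types (c : R -> 'rV[R]_N) (s t : R).

Local Notation mul := (gmul G).
Local Notation inv := (ginv G).
Local Notation one := (gone G).
Local Notation o := (chart i one).

(** Little-o of [t - s] from the right only, to match curves controlled on that side. *)
Definition right_o n s (f : R -> 'rV[R]_n) : Prop := forall e, 0 < e ->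
  exists2 r, 0 < r & forall t, s < t -> t < s + r -> `|f t| <= e * (t - s).

Lemma right_o_add n s (f h : R -> 'rV[R]_n) :
  right_o s f -> right_o s h -> right_o s (fun t => f t + h t).
Proof.
move=> of_ oh e e0; have e2 : 0 < e / 2 by rewrite divr_gt0.
have [r r0 hr] := of_ _ e2; have [q q0 hq] := oh _ e2.
exists (Num.min r q) => [|t st]; first by rewrite lt_min r0.
rewrite -ltrBlDl lt_min !ltrBlDl => /andP[tr tq].
apply: le_trans (ler_normD _ _) (le_trans (lerD (hr t st tr) (hq t st tq)) _).
by rewrite -mulrDl -splitr.
Qed.

Lemma right_o_mulmx n q s (f : R -> 'rV[R]_n) (L : 'M[R]_(n, q)) :
  right_o s f -> right_o s (fun t => f t *m L).
Proof.
move=> of_ e e0; have [C C0 hC] := norm_mulmx L.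
have [r r0 hr] := of_ _ (divr_gt0 e0 C0); exists r => // t st tr.
apply: le_trans (hC _) _; rewrite -ler_pdivlMl //.
by apply: le_trans (hr t st tr) _; rewrite mulrA (mulrC C^-1).
Qed.

Lemma right_o_opp n s (f : R -> 'rV[R]_n) : right_o s f -> right_o s (fun t => - f t).
Proof.
by move=> of_ e /of_[r r0 hr]; exists r => // t st tr; rewrite normrN hr.
Qed.

Lemma right_o_eq n s r (f h : R -> 'rV[R]_n) : 0 < r ->
  (forall t, s < t -> t < s + r -> f t = h t) -> right_o s f -> right_o s h.
Proof.
move=> r0 fh of_ e /of_[q q0 hq].
exists (Num.min r q) => [|t st]; first by rewrite lt_min r0.
rewrite -ltrBlDl lt_min !ltrBlDl => /andP[tr tq].
by rewrite -fh // hq.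
Qed.

(* The increment after s is translated back to the identity on the right, which
   makes increments additive modulo the ideal. *)
Definition incr c s t : 'rV[R]_d := chart i (mul (c t) (inv (c s))) - o.

(** Measured at the identity after translation, so that [c s] may lie in any chart while all
    increments are compared in the chart [i]. *)
Definition right_lipschitz c s : Prop := carrier G (c s) /\
  exists C r, [/\ 0 < C, 0 < r & forall t, s < t -> t < s + r ->
    [/\ carrier G (c t), dom i (mul (c t) (inv (c s))) & `|incr c s t| <= C * (t - s)]].

Lemma gdiff_comp m n j (F : 'rV[R]_n -> 'rV[R]_N) (f : 'rV[R]_m -> 'rV[R]_n) z L K :
  hasdiff f z K -> gdiff j F (f z) L -> gdiff (X := X) j (fun y => F (f y)) z (K *m L).
Proof.
move=> df [[e e0 he] dF]; split; last exact: hasdiff_comp df dF.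
by have [r r0 hr] := hasdiff_cont df e0; exists r => // y /hr; apply: he.
Qed.

Lemma hasdiff_lsubmx (w : 'rV[R]_(d + d)) :
  hasdiff (fun w => lsubmx w) w (col_mx 1%:M 0 : 'M_(d + d, d)).
Proof.
apply: hasdiff_near ltr01 _ (hasdiff_lin _ w) => y _.
by rewrite -{1}[y]hsubmxK mul_row_col mulmx0 mulmx1 addr0.
Qed.

(** The map [(u, v) |-> u (g v g^-1)] is the model for the increment of a product of two curves. *)
Lemma mul_conj_gdiff g : carrier G g -> exists L,
  gdiff i (fun w : 'rV[R]_(d + d) => mul (chart_inv i (lsubmx w))
      (mul (mul g (chart_inv i (rsubmx w))) (inv g))) (row_mx o o) L /\
  forall u v : 'rV[R]_d, row_mx u v *m L = u + v *m AdM i g.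
Proof.
move=> Gg.
have dF1 : gdiff i (fun w : 'rV[R]_(d + d) => chart_inv i (lsubmx w))
    (row_mx o o) (col_mx 1%:M 0 *m 1%:M).
  apply: (gdiff_comp (hasdiff_lsubmx _)); rewrite row_mxKl.
  exact: gdiff_chart_inv (chart_image_o i1).
have dF2 : gdiff i (fun w : 'rV[R]_(d + d) =>
    mul (mul g (chart_inv i (rsubmx w))) (inv g)) (row_mx o o) (col_mx 0 1%:M *m AdM i g).
  apply: (gdiff_comp (hasdiff_rsubmx _)
    (F := fun u => mul (mul g (chart_inv i u)) (inv g))).
  by rewrite row_mxKr; apply: conj_AdM.
have E1 : chart_inv i (lsubmx (row_mx o o)) = one by rewrite row_mxKl chart_inv_o.
have E2 : mul (mul g (chart_inv i (rsubmx (row_mx o o)))) (inv g) = one.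
  by rewrite row_mxKr chart_inv_o // (proj2 (gmul1 Gg)) (proj2 (gmulV Gg)).
have := gdiff_mul p2 dF1 dF2 (l := i).
rewrite E1 E2 (proj1 (gmul1 (one_closed G))) => /(_ i1) dF.
eexists; split; first exact: dF.
move=> u v; rewrite mulmxA mul_mx_row !mulmxA !mul_row_col.
by rewrite !mulmx0 !mulmx1 addr0 add0r jac_oo.
Qed.

(** With [a = c1 t (c1 s)^-1] and [b = c2 t (c2 s)^-1], the translated increment of the product is
    [a (c1 s b (c1 s)^-1)], to which the derivative of the model map applies. The Lipschitz bounds
    turn an error small relative to the increments into one small relative to [t - s]. *)
Lemma incr_mul c1 c2 s : right_lipschitz c1 s -> right_lipschitz c2 s ->
  right_lipschitz (fun t => mul (c1 t) (c2 t)) s /\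
  right_o s (fun t => incr (fun t => mul (c1 t) (c2 t)) s t
                      - (incr c1 s t + incr c2 s t *m AdM i (c1 s))).
Proof.
move=> [G1 [C1 [r1 [C10 r10 h1]]]] [G2 [C2 [r2 [C20 r20 h2]]]].
have [L [[[e0 e00 he0] dF] LE]] := mul_conj_gdiff G1.
have [B [e3 [B0 e30 h3]]] := hasdiff_lip dF.
pose z t := row_mx (chart i (mul (c1 t) (inv (c1 s)))) (chart i (mul (c2 t) (inv (c2 s)))).
have C120 : 0 < C1 + C2 by rewrite addr_gt0.
have zE t : z t - row_mx o o = row_mx (incr c1 s t) (incr c2 s t).
  by rewrite opp_row_mx add_row_mx.
have zle t : s < t -> t < s + r1 -> t < s + r2 -> `|z t - row_mx o o| <= (C1 + C2) * (t - s).
  move=> st t1 t2; rewrite zE mulrDl; apply: le_trans (norm_row_mx _ _) (lerD _ _).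
    by case: (h1 t st t1).
  by case: (h2 t st t2).
have FE t : s < t -> t < s + r1 -> t < s + r2 ->
    mul (chart_inv i (lsubmx (z t)))
      (mul (mul (c1 s) (chart_inv i (rsubmx (z t)))) (inv (c1 s))) =
    mul (mul (c1 t) (c2 t)) (inv (mul (c1 s) (c2 s))).
  move=> st t1 t2; have [Gt1 d1 _] := h1 t st t1; have [Gt2 d2 _] := h2 t st t2.
  rewrite row_mxKl row_mxKr !chartK // ginvM //.
  have [V1 V2] := (inv_closed G1, inv_closed G2).
  have G12 := mul_closed Gt2 V2.
  rewrite -(gmulA G1 G12 V1) (gmulA (mul_closed Gt1 V1) G1 (mul_closed G12 V1)).
  rewrite gmulKV // -(gmulA Gt2 V2 V1) (gmulA Gt1 Gt2) //; exact: mul_closed.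
have Fo : mul (chart_inv i (lsubmx (row_mx o o)))
      (mul (mul (c1 s) (chart_inv i (rsubmx (row_mx o o)))) (inv (c1 s))) = one.
  rewrite row_mxKl row_mxKr (chart_inv_o i1) (proj2 (gmul1 G1)) (proj2 (gmulV G1)).
  exact: (proj1 (gmul1 (one_closed G))).
(* Keeps [t] in the range of both Lipschitz bounds and [z t] within [q] of its base point. *)
pose r0 (q : R) := Num.min (Num.min r1 r2) (q / (C1 + C2)).
have r00 q : 0 < q -> 0 < r0 q by move=> q0; rewrite !lt_min r10 r20 divr_gt0.
have r0P q t : s < t -> t < s + r0 q ->
    [/\ t < s + r1, t < s + r2 & `|z t - row_mx o o| < q].
  move=> st; rewrite -ltrBlDl !lt_min ltr_pdivlMr // => /andP[/andP[t1 t2] t3].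
  rewrite -!ltrBlDl; split=> //; apply: le_lt_trans t3.
  by rewrite mulrC; apply: zle; rewrite // -ltrBlDl.
split.
  split; first exact: mul_closed.
  exists (B * (C1 + C2)), (Num.min (r0 e0) (r0 e3)); split.
  - by rewrite mulr_gt0.
  - by rewrite lt_min !r00.
  - move=> t st; rewrite -ltrBlDl lt_min !ltrBlDl => /andP[/(r0P _ _ st)[t1 t2 zt0]].
    move=> /(r0P _ _ st)[_ _ zt3].
    have [[Gt1 _ _] [Gt2 _ _]] := (h1 t st t1, h2 t st t2).
    split; first exact: mul_closed.
      by rewrite -(FE t st t1 t2); apply: he0.
    have := h3 _ zt3; rewrite FE // Fo => /le_trans; apply.
    by rewrite -mulrA ler_pM2l // zle.
move=> e e_0; have [e1 e10 he1] := dF _ (divr_gt0 e_0 C120).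
exists (r0 e1) => [|t st /(r0P _ _ st)[t1 t2 zt]]; first exact: r00.
have := he1 _ zt; rewrite FE // Fo zE LE => /le_trans; apply.
rewrite -zE mulrAC ler_pdivrMr // -mulrA ler_pM2l // mulrC.
exact: zle.
Qed.

End Curves.

(** * Curves of products of commutators *)

Section CommutatorCurves.
Variables (R : rcfType) (M : ominimal R) (N : nat) (G : defGroup M N).
Variables (p d : nat) (X : defAtlas G p d).
Hypothesis p2 : (2 <= p)%N.
Variable i : idx X.
Hypothesis i1 : dom i (gone G).
Implicit Types (c : R -> 'rV[R]_N) (s t a b : R).

Local Notation mul := (gmul G).
Local Notation inv := (ginv G).
Local Notation one := (gone G).
Local Notation o := (chart i one).

Lemma rlip_row n (f : R -> 'rV[R]_n) s : (forall k, rlip (fun t => f t 0 k) s) ->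
  exists C r, [/\ 0 < C, 0 < r &
    forall t, s < t -> t < s + r -> `|f t - f s| <= C * (t - s)].
Proof.
move=> fl.
have F k : exists q : R * R, 0 < q.2 /\
    forall t, s < t -> t < s + q.2 -> `|f t 0 k - f s 0 k| <= q.1 * (t - s).
  have [C [r [r0 h]]] := fl k; exists (C, r); split=> // t st tr.
  by rewrite ler_norml; apply/andP; apply: h.
have [q qP] := choice F.
have C0 : 0 <= \sum_k `|(q k).1| by apply: sumr_ge0.
exists (\sum_k `|(q k).1| + 1), (\big[Num.min/1]_k (q k).2); split.
- by rewrite ltr_wpDl.
- by apply/bigmin_gtP; split=> // k _; case: (qP k).
move=> t st; rewrite -ltrBlDl => /bigmin_gtP[_ tr]; have ts : 0 < t - s by rewrite subr_gt0.
apply: norm_row_le => [|k]; first by rewrite mulr_ge0 ?ltW // ltr_wpDl.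
rewrite !mxE; have [_ /(_ t st)] := qP k; rewrite -ltrBlDl => /(_ (tr k isT)) /le_trans; apply.
rewrite ler_pM2r //; apply: (le_trans (ler_norm _)).
by rewrite (bigD1 k) //= -addrA lerDl addr_ge0 // sumr_ge0.
Qed.

(** Finitely many charts cover, so [c] stays in one of them on a subinterval; its coordinates there
    are generically right-Lipschitz, and translation to the identity is differentiable. *)
Lemma right_lipschitz_generic c a b : a < b -> dfun M c ->
  (forall t, a < t < b -> carrier G (c t)) -> has_itv (right_lipschitz i c) a b.
Proof.
move=> ab dc Gc.
have [||j _ [u [v [au uv vb uvj]]]] := @itv_cover _ M _ (enum (idx X))
    (fun j t => dom j (c t)) a b ab.
- move=> j _; have dj : dpred M (dom j) by exact: dom_def.
  by definability.
- by move=> t /Gc/(carrier_dom X)[j jt]; exists j; rewrite ?mem_enum.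
have [ch [dch chE]] := total_chart j.
have dk k : dfun M (fun t => ch (c t) 0 k) by definability.
have [q [r [uq qr rv h]]] := itv_all_fin uv (fun k a b ab => rlip_generic ab (dk k)).
exists q, r; split=> //; try lra.
move=> s sqr; have suv : u < s < v by lra.
have js := uvj s suv; have Gs := dom_carrier js; split=> //.
have [C [e [C0 e0 he]]] := rlip_row (h s sqr).
have ij := chart_imageP js.
have se : mul (chart_inv j (chart j (c s))) (inv (c s)) = one.
  by rewrite chartK // (proj2 (gmulV Gs)).
have [|L [[e1 e10 he1] dF]] := transl_gdiff p2 (l := i) ij (inv_closed Gs).
  by rewrite se.
have [B [e2 [B0 e20 h2]]] := hasdiff_lip dF.
(* The term [v - s] keeps [c t] in the chart [j]; dividing by [C] turns the radii [e1] and [e2] in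
   the chart into bounds on [t - s]. *)
pose q0 := Num.min (Num.min e (v - s)) (Num.min (e1 / C) (e2 / C)).
exists (B * C), q0; split.
- exact: mulr_gt0.
- by rewrite !lt_min e0 !divr_gt0 // subr_gt0; lra.
move=> t st; rewrite -ltrBlDl !lt_min => /andP[/andP[te tv] /andP[]].
rewrite !ltr_pdivlMr // !(mulrC _ C) => t1 t2.
have jt : dom j (c t) by apply: uvj; lra.
have := he t st; rewrite !chE // => /(_ ltac:(lra)) le1.
have {t1}t1 := le_lt_trans le1 t1; have {t2}t2 := le_lt_trans le1 t2.
split; first exact: dom_carrier jt.
  by have := he1 _ t1; rewrite chartK.
have := h2 _ t2; rewrite se chartK // => /le_trans; apply.
by rewrite (mulrC C) -mulrA ler_pM2l.
Qed.

Lemma commutator_products_carrier n x : commutator_products G n x -> carrier G x.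
Proof.
elim: n x => [|n IH] x /=; first by move->; exact: one_closed.
move=> [c [y [z [/IH Gc Gy Gz ->]]]].
by do !apply: mul_closed => //; apply: inv_closed.
Qed.

Lemma total_commutator : exists mu comm : 'rV[R]_N * 'rV[R]_N -> 'rV[R]_N,
  [/\ dfun M mu, dfun M comm,
    forall x y, carrier G x -> carrier G y -> mu (x, y) = mul x y &
    forall x y, carrier G x -> carrier G y -> comm (x, y) = commutator G x y].
Proof.
have [mu [dmu muE]] := total_mul G; have [iv [div ivE]] := total_inv G.
exists mu, (fun q => mu (mu (q.1, q.2), mu (iv q.1, iv q.2))); split=> // [|x y Gx Gy /=].
  by definability.
have [Vx Vy] := (inv_closed Gx, inv_closed Gy).
rewrite !ivE // (muE x y) // (muE (inv x)) // muE //; exact: mul_closed.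
Qed.

Lemma commutator_closed x y : carrier G x -> carrier G y -> carrier G (commutator G x y).
Proof. by move=> Gx Gy; do !apply: mul_closed => //; apply: inv_closed. Qed.

Lemma definable_commutator_products n : dpred M (commutator_products G n).
Proof.
have [mu [comm [dmu dcomm muE commE]]] := total_commutator.
have dG : dpred M (carrier G) by exact: carrier_def.
elim: n => [|n IH]; first by apply: deq; [exact: dfun_id|exact: dfun_cst].
have dcp : dpred M (fun z => exists g, exists x, exists y, commutator_products G n g /\
    carrier G x /\ carrier G y /\ z = mu (g, comm (x, y))) by definability.
apply: (eq_dpred dcp) => z; split=> -[c [x [y]]].
  move=> [cn [Gx [Gy ->]]]; exists c, x, y; split=> //.
  have Gc := commutator_products_carrier cn.
  by rewrite commE // muE //; apply: commutator_closed.
move=> [cn Gx Gy ->]; exists c, x, y; split=> //; split=> //; split=> //.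
have Gc := commutator_products_carrier cn.
by rewrite commE // muE //; apply: commutator_closed.
Qed.

Variable P : 'M[R]_d.
Hypothesis AdP : forall g, carrier G g -> AdM i g *m P = P.

Lemma incr_mul_quotient c1 c2 s : right_lipschitz i c1 s -> right_lipschitz i c2 s ->
  right_o s (fun t => incr i (fun t => mul (c1 t) (c2 t)) s t *m P
                      - (incr i c1 s t *m P + incr i c2 s t *m P)).
Proof.
move=> l1 l2; have [_ /(right_o_mulmx P)] := incr_mul p2 i1 l1 l2.
apply: right_o_eq ltr01 _ => t _ _; rewrite mulmxBl [(incr i c1 s t + _) *m P]mulmxDl.
by rewrite -[incr i c2 s t *m _ *m P]mulmxA AdP //; case: l1.
Qed.

(* Write c = e [x, y]; then c (y x) = e (x y), so to first order modulo the
   ideal the increment of c is that of e. *)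
Lemma incr_commutator c e x y s r : 0 < r ->
  right_lipschitz i c s -> right_lipschitz i e s ->
  right_lipschitz i x s -> right_lipschitz i y s ->
  (forall t, s <= t -> t < s + r ->
     mul (c t) (mul (y t) (x t)) = mul (e t) (mul (x t) (y t))) ->
  right_o s (fun t => incr i e s t *m P) -> right_o s (fun t => incr i c s t *m P).
Proof.
move=> r0 lc le lx ly E oe.
have ss : s < s + r by rewrite ltrDl.
have [lyx _] := incr_mul p2 i1 ly lx; have [lxy _] := incr_mul p2 i1 lx ly.
have oA1 := incr_mul_quotient lc lyx; have oA2 := incr_mul_quotient ly lx.
have oB1 := incr_mul_quotient le lxy; have oB2 := incr_mul_quotient lx ly.
(* In this combination the increments of the two equal products, of [e], of [x] and of [y] all
   cancel, and exactly that of [c] remains. *)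
apply: right_o_eq r0 _ (right_o_add (right_o_add (right_o_add oB1 oe) oB2)
  (right_o_opp (right_o_add oA1 oA2))) => t st tr /=.
have -> : incr i (fun t => mul (c t) (mul (y t) (x t))) s t =
    incr i (fun t => mul (e t) (mul (x t) (y t))) s t.
  by rewrite /incr /= (E t (ltW st) tr) (E s (lexx s) ss).
set I1 := incr i (fun t => mul (e t) _) s t *m P.
set I2 := incr i (fun t => mul (x t) _) s t *m P.
set I3 := incr i (fun t => mul (y t) _) s t *m P.
move: I1 I2 I3 (incr i c s t *m P) (incr i e s t *m P)
  (incr i x s t *m P) (incr i y s t *m P) => I1 I2 I3 Ic Ie Ix Iy.
by apply/rowP => k; rewrite !mxE; ring.
Qed.

(** The Lipschitz property is part of the conclusion because the next step of the induction needs it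
    for the factor [e]. Curve and interval are generalized, as [e] is chosen on a smaller
    interval. *)
Lemma commutator_flat n c a b : a < b -> dfun M c ->
  (forall t, a < t < b -> commutator_products G n (c t)) ->
  has_itv (fun s => right_lipschitz i c s /\ right_o s (fun t => incr i c s t *m P)) a b.
Proof.
elim: n c a b => [|n IH] c a b ab dc hc.
  have Gc t : a < t < b -> carrier G (c t) by move=> /hc ->; apply: one_closed.
  have [u [v [au uv vb h]]] := right_lipschitz_generic ab dc Gc.
  exists u, v; split=> // s suv; split; first exact: h.
  have r0 : 0 < b - s by lra.
  apply: right_o_eq r0 _ (_ : right_o s (fun=> 0)) => [t st tb|e e0].
    have [ct cs] : c t = one /\ c s = one by split; apply: hc; lra.
    by rewrite /incr ct cs ginv1 (proj1 (gmul1 (one_closed G))) subrr mul0mx.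
  by exists 1 => // t st _; rewrite normr0 mulr_ge0 ?ltW // subr_gt0.
have [mu [comm [dmu dcomm muE commE]]] := total_commutator.
have dG : dpred M (carrier G) by exact: carrier_def.
have dn := definable_commutator_products n.
have cT : has_choice M ('rV[R]_N * 'rV[R]_N * 'rV[R]_N)%type.
  by do !apply: has_choice_prod; apply: has_choice_row.
have [||f [df [u [v [au uv vb hf]]]]] := cT (fun t z => commutator_products G n z.1.1 /\
    carrier G z.1.2 /\ carrier G z.2 /\ c t = mu (z.1.1, comm (z.1.2, z.2))) a b ab.
- by definability.
- move=> t /hc[e [x [y [en Gx Gy ->]]]]; exists (e, x, y) => /=; do !split=> //.
  rewrite commE // muE //; last exact: commutator_closed.
  exact: commutator_products_carrier en.
pose e t := (f t).1.1; pose x t := (f t).1.2; pose y t := (f t).2.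
have de : dfun M e by rewrite /e; definability.
have dx : dfun M x by rewrite /x; definability.
have dy : dfun M y by rewrite /y; definability.
have en t : u < t < v -> commutator_products G n (e t) by move=> /hf[].
have Ge t : u < t < v -> carrier G (e t) by move=> /en/commutator_products_carrier.
have Gx t : u < t < v -> carrier G (x t) by move=> /hf[_ []].
have Gy t : u < t < v -> carrier G (y t) by move=> /hf[_ [_ []]].
have cE t : u < t < v -> c t = mul (e t) (commutator G (x t) (y t)).
  move=> tuv; have [_ [_ [_ ->]]] := hf t tuv.
  rewrite commE ?muE //; [exact: Ge|apply: commutator_closed|exact: Gx|exact: Gy];
    [exact: Gx|exact: Gy].
have [u1 [v1 [uu1 uv1 vv1 h1]]] := IH e u v uv de en.
have [|u2 [v2 [uu2 uv2 vv2 h2]]] := @right_lipschitz_generic x u1 v1 uv1 dx.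
  by move=> t t1; apply: Gx; lra.
have [|u3 [v3 [uu3 uv3 vv3 h3]]] := @right_lipschitz_generic y u2 v2 uv2 dy.
  by move=> t t1; apply: Gy; lra.
have [|u4 [v4 [uu4 uv4 vv4 h4]]] := @right_lipschitz_generic c u3 v3 uv3 dc.
  move=> t t1; rewrite cE; last lra.
  by apply: mul_closed; [apply: Ge|apply: commutator_closed; [apply: Gx|apply: Gy]]; lra.
exists u4, v4; split=> //; try lra.
move=> s s4; have suv : u < s < v by lra.
have [|le oe] := h1 s; first lra.
have lc := h4 s s4; split=> //.
apply: (@incr_commutator c e x y s (v - s)) => //.
- lra.
- by apply: h2; lra.
- by apply: h3; lra.
move=> t st tv; have tuv : u < t < v by lra.
have [[Get Gxt] Gyt] := (Ge t tuv, Gx t tuv, Gy t tuv).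
have Gyx := mul_closed Gyt Gxt; have Gxy := mul_closed Gxt Gyt.
(* The commutator is [(x y) (y x)^-1], so multiplying by [y x] on the right cancels both
   inverses. *)
have ct : c t = mul (e t) (mul (mul (x t) (y t)) (inv (mul (y t) (x t)))).
  by rewrite (cE t tuv) /commutator (ginvM Gyt Gxt).
by rewrite ct -(gmulA Get (mul_closed Gxy (inv_closed Gyx)) Gyx) (gmulKV Gxy Gyx).
Qed.

End CommutatorCurves.

(** * Velocities of curves of commutators *)

Section Velocity.
Variables (R : rcfType) (M : ominimal R) (N : nat) (G : defGroup M N).
Variables (p d : nat) (X : defAtlas G p d).
Hypothesis p2 : (2 <= p)%N.
Variable i : idx X.
Hypothesis i1 : dom i (gone G).
Implicit Types (s t a b : R).

Local Notation mul := (gmul G).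
Local Notation inv := (ginv G).
Local Notation one := (gone G).
Local Notation o := (chart i one).

Lemma right_o_hasdiff m n (f : 'rV[R]_m -> 'rV[R]_n) z L (g : R -> 'rV[R]_m) s C r :
  hasdiff f z L -> 0 < C -> 0 < r ->
  (forall t, s < t -> t < s + r -> `|g t - z| <= C * (t - s)) ->
  right_o s (fun t => f (g t) - f z - (g t - z) *m L).
Proof.
move=> df C0 r0 hg e e0; have [q q0 hq] := df _ (divr_gt0 e0 C0).
exists (Num.min r (q / C)) => [|t st]; first by rewrite lt_min r0 divr_gt0.
rewrite -ltrBlDl lt_min ltr_pdivlMr // ltrBlDl => /andP[tr tq].
have le1 := hg t st tr; apply: le_trans (hq _ _) _.
  by apply: le_lt_trans le1 _; rewrite mulrC.
by rewrite mulrAC ler_pdivrMr // -mulrA ler_pM2l // mulrC.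
Qed.

Lemma right_o_linear n s (v : 'rV[R]_n) : right_o s (fun t => (t - s) *: v) -> v = 0.
Proof.
move=> ov; apply/eqP; rewrite -normr_eq0; apply/negPn/negP => n0.
have {}n0 : 0 < `|v| by rewrite lt_neqAle eq_sym n0 normr_ge0.
have [|r r0 h] := ov (`|v| / 2); first by rewrite divr_gt0.
have := h (s + r / 2) ltac:(lra) ltac:(lra).
rewrite addrAC subrr add0r normrZ gtr0_norm ?divr_gt0 //.
by have := mulr_gt0 r0 n0; lra.
Qed.

Lemma continuous_eps n (f : R -> 'rV[R]_n) s : {for s, continuous f} ->
  forall e, 0 < e -> exists2 r, 0 < r & forall t, `|t - s| < r -> `|f t - f s| < e.
Proof.
move=> cf e e0.
have := (proj1 (@cvgrPdist_lt R 'rV[R]_n R (nbhs s) (nbhs_filter s) f (f s)) cf) e e0.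
move=> /(nbhs_normP s (fun t => `|f s - f t| < e))[r /= r0 hr].
by exists r => // t ts; rewrite distrC; apply: hr; rewrite /ball_ /= distrC.
Qed.

Lemma derivative_eps n (f : R -> 'rV[R]_n) s : differentiable f s ->
  forall e, 0 < e -> exists2 r, 0 < r &
    forall t, `|t - s| < r -> `|f t - f s - (t - s) *: ('D_1 f s : 'rV[R]_n)| <= e * `|t - s|.
Proof.
move=> df e e0; have [r r0 h] := differentiable_eps df e0.
exists r => // t /h; rewrite deriveE // -linearZ /=.
by rewrite [_ *: _]mulr1.
Qed.

Variable P : 'M[R]_d.
Hypothesis AdP : forall g, carrier G g -> AdM i g *m P = P.

(* Theta at (gamma' s, gamma s) is the velocity of gamma at s, translated back to
   the identity on the right. *)
Lemma velocity_quotient (gamma : R -> 'rV[R]_N) s e :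
  0 < e -> (forall t, s <= t -> t < s + e -> dom i (gamma t)) ->
  dom i (inv (gamma s)) ->
  differentiable (fun t => chart i (gamma t)) s ->
  right_o s (fun t => incr i gamma s t *m P) ->
  Theta i (row_mx ('D_1 (fun t => chart i (gamma t)) s : 'rV[R]_d) (chart i (gamma s))) *m P = 0.
Proof.
move=> e0 ig iV dg og; set cg := fun t => chart i (gamma t).
have igs : dom i (gamma s) by apply: ig; rewrite ?lexx // ltrDl.
have Gs := dom_carrier igs; set u := cg s; set D := 'D_1 cg s : 'rV[R]_d.
have iu : chart_image i u by exists (gamma s).
have Eu : chart_inv i u = gamma s by exact: chartK.
have Wq : mulW i i i (row_mx u (cinv i u)).
  by apply: mulW_cinv => //; rewrite Eu.
rewrite (ThetaE p2 _ Wq); set J := jac i i i _.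
have dm := cmul_hasdiff p2 Wq.
have mE t : s <= t -> t < s + e ->
    cmul i i i (row_mx (cg t) (cinv i u)) = chart i (mul (gamma t) (inv (gamma s))).
  by move=> st te; rewrite /cinv Eu cmulE //; apply: ig.
have mq : cmul i i i (row_mx u (cinv i u)) = o.
  by rewrite (mE s) ?lexx ?ltrDl // (proj2 (gmulV Gs)).
have ov : right_o s (fun t => cg t - u - (t - s) *: D).
  move=> e' e'0; have [r r0 h] := derivative_eps dg e'0; exists r => // t st tr.
  have ts : `|t - s| = t - s by rewrite gtr0_norm // subr_gt0.
  by have := h t; rewrite ts; apply; rewrite ltrBlDl.
have [r r0 hr] := ov 1 ltr01.
have D1 : 0 < 1 + `|D| by rewrite ltr_pwDl.
have rowE t : row_mx (cg t) (cinv i u) - row_mx u (cinv i u) = row_mx (cg t - u) 0.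
  by rewrite opp_row_mx add_row_mx subrr.
have lip t : s < t -> t < s + r ->
    `|row_mx (cg t) (cinv i u) - row_mx u (cinv i u)| <= (1 + `|D|) * (t - s).
  move=> st tr; rewrite rowE; apply: le_trans (norm_row_mx _ _) _.
  rewrite normr0 addr0 -[cg t - u](subrK ((t - s) *: D)) mulrDl.
  apply: le_trans (ler_normD _ _) (lerD (hr t st tr) _).
  by rewrite normrZ gtr0_norm ?subr_gt0 // mulrC.
(* Up to [o(t - s)], the increment is the Jacobian applied to the displacement in the chart, hence
   to [(t - s) *: D]. Being itself [o(t - s)] modulo [P], it forces that linear term to vanish. *)
have o1 := right_o_hasdiff dm D1 r0 lip.
have o2 := right_o_mulmx (row_mx 1%:M 0 *m J *m P) ov.
have o3 := right_o_add (right_o_opp (right_o_add (right_o_mulmx P o1) o2)) og.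
apply: (@right_o_linear _ s); apply: right_o_eq e0 _ o3 => t st te /=.
rewrite rowE (mE t (ltW st) te) mq -/(incr i gamma s t).
have rE (y : 'rV[R]_d) : y *m (row_mx 1%:M 0 *m J *m P) = row_mx y 0 *m J *m P.
  by rewrite !mulmxA mul_mx_row mulmx1 mulmx0.
have -> : row_mx D 0 *m J *m P = D *m (row_mx 1%:M 0 *m J *m P) by rewrite rE.
rewrite mulmxBl -rE.
rewrite [(_ - (t - s) *: D) *m _]mulmxBl -scalemxAl.
move: (incr i gamma s t *m P) ((cg t - u) *m _) (D *m _) => x y z.
by apply/rowP => k; rewrite !mxE; ring.
Qed.

End Velocity.

(** The complementary projection turns congruence modulo [I] into an equation between matrices. *)
Lemma vspace_kernel (R : rcfType) d (I : {vspace 'rV[R]_d}) :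
  exists P : 'M[R]_d, forall v, v \in I <-> v *m P = 0.
Proof.
exists (lin1_mx (\1 - projv I)%VF) => v; rewrite mul_rV_lin1 /= add_lfunE id_lfunE opp_lfunE.
split=> [/projv_id->|/eqP]; first by rewrite subrr.
by rewrite subr_eq0 => /eqP->; exact: memv_proj.
Qed.

Theorem theorem5p1 (R : rcfType) (M : ominimal R) (N : nat)
  (G : defGroup M N) (p d : nat) (X : defAtlas G p d) (i : idx X)
  (A I : {vspace 'rV[R]_d}) :
  (2 <= p)%N ->
  dom i (gone G) ->
  definably_connected X ->
  subalgebra i A -> central i A ->
  ideal i I ->
  (A + I)%VS = fullv ->
  forall xi : 'rV[R]_d, Lie_commutator_subgroup i xi -> xi \in I.
Proof.
move=> p2 i1 conn _ cA idI full xi [n [U [_ _ _ _ tan]]].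
have [P PE] := vspace_kernel I.
have bracketP v eta : bracket i v eta *m P = 0.
  apply/PE; have : v \in (A + I)%VS by rewrite full memvf.
  move=> /memv_addP[a aA [b bI ->]].
  rewrite /bracket linearD -/(bracket i a eta) -/(bracket i b eta).
  by apply: memvD; [rewrite cA ?mem0v|apply: idI].
have AdP := AdM_quotient p2 i1 bracketP conn.
have [eps [gamma [eps0 [dgamma [g1 [gU [[dg /(_ 1) cD] gxi]]]]]]] := tan.
apply/PE; apply/eqP; rewrite -normr_eq0; apply/negPn/negP => n0.
have {}n0 : 0 < `|xi *m P| by rewrite lt_neqAle eq_sym n0 normr_ge0.
set cg := fun t => chart i (gamma t).
have D0 : 'D_1 cg 0 = xi by rewrite -derive1E.
have inB t : `|t| < eps -> dom i (gamma t) by move=> /gU[].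
have [L dTh] := Theta_hasdiff p2 i1 xi.
(* Within [q] of [(xi, o)], where [Theta] is [xi], the value modulo [P] differs from [xi *m P] by
   less than the norm of the latter, so it cannot be zero. *)
have [q q0 hq] := hasdiff_cont (hasdiff_comp dTh (hasdiff_lin P _)) n0.
have [en en0 hn] := near_o p2 i1.
have eps00 : `|0 : R| < eps by rewrite normr0.
have [r1 r10 h1] := continuous_eps (cD 0 eps00) q0.
have qen0 : 0 < Num.min q en by rewrite lt_min q0.
have [r2 r20 h2] := continuous_eps (differentiable_continuous (dg 0 eps00)) qen0.
pose r := Num.min eps (Num.min r1 r2).
have r0 : 0 < r by rewrite !lt_min eps0 r10.
have dball : definable M [set t : 'rV[R]_1 | `|t 0 0| < eps].
  have db : dpred M (fun t : R => - eps < t /\ t < eps) by definability.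
  by apply: (eq_definable db) => t /=; rewrite ltr_norml; split=> [[-> ->]|/andP].
have [F [dF FE]] := definable_map_total dball dgamma.
(* The curve is definable only on its interval; [c] is a total definable function agreeing with it
   there. *)
pose c t := F (const_mx t).
have cE t : `|t| < eps -> c t = gamma t by move=> te; rewrite /c FE /= mxE.
have dc : dfun M c by apply: (dfun_comp dF); apply: dproj_dfun; exists id.
have small t : 0 < t < r -> [/\ `|t| < eps, `|t - 0| < r1 & `|t - 0| < r2].
  by move=> /andP[t0]; rewrite subr0 gtr0_norm // !lt_min => /and3P[].
have [|a [b [a0 ab br flat]]] := commutator_flat p2 i1 AdP r0 dc (n := n).
  by move=> t /small[te _ _]; rewrite cE //; have [[_]] := gU t te.
pose s := (a + b) / 2.
have sab : a < s < b by rewrite /s; lra.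
have [se s1 s2] := small s ltac:(lra); have [_ os] := flat s sab.
have : `|cg s - cg 0| < Num.min q en := h2 s s2.
(* The radius [en] also places the inverse of [gamma s] in the chart, as translating the velocity
   back requires. *)
rewrite lt_min /cg g1 => /andP[csq /hn[_ iV]].
have n1 : `|Theta i (row_mx ('D_1 cg s : 'rV[R]_d) (cg s)) *m P - xi *m P| < `|xi *m P|.
  have := hq (row_mx ('D_1 cg s) (cg s)); rewrite Theta_o //; apply.
  by apply/norm_row_mx_ltP; split=> //; have := h1 s s1; rewrite /= -/cg D0.
have e0 : 0 < eps - s by move: se; rewrite gtr0_norm; lra.
have ball t : s <= t -> t < s + (eps - s) -> `|t| < eps.
  by move=> st te; rewrite gtr0_norm; lra.
have := n1; rewrite (velocity_quotient p2 i1 e0 (s := s)).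
- by rewrite sub0r normrN ltxx.
- by move=> t st te; apply/inB/ball.
- by move: iV; rewrite chartK //; apply: inB.
- exact: dg.
apply: right_o_eq e0 _ os => t st te.
by rewrite /incr !cE //; apply: ball; lra.
Qed.
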